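(* Setting $X=q^{-3s_0}$, $Y=q^{-s_1+2}$, $Z=q^{-2s_2+2}$, we have $$\Xi_{3,\{1,2\}}(s_0,s_1,s_2)=\frac{YZ\;P(X,Y,Z;q)}{q^{11}(1-X)(1-XY)(1-XZ)(1-q^{-2}Y)(1-q^{-2}Z)(1-q^{-3}YZ)(1-q^{-1}XYZ)},$$ where $P(X,Y,Z;q)=a_0+a_1X+a_2X^2+a_3X^3$ with $$\begin{aligned} a_0&=(4q^8+10q^7)+(8q^6-4q^5)Y-18q^4YZ,\\ a_1&=(q^{10}+8q^9-3q^8-10q^7)+(2q^8-11q^7-q^6)Z+(5q^8-20q^7-9q^6+4q^5)Y\\ &\quad+(-q^7-32q^6+6q^5+19q^4)YZ+(-6q^5+19q^4+q^3)YZ^2\\ &\quad+(-5q^5+12q^4+5q^3)Y^2Z+(12q^3+5q^2-q)Y^2Z^2,\\ a_2&=(q^{11}+q^{10}-6q^9)+(-q^9-7q^8+18q^7)Y+(-q^9-4q^8+9q^7)Z\\ &\quad+(-14q^8+5q^7+32q^6-5q^5)YZ+(11q^6+6q^5-17q^4)YZ^2+(8q^6+14q^5-10q^4-4q^3)Y^2Z\\ &\quad+(13q^5+2q^4-18q^3-7q^2)Y^2Z^2+(-7q^3-7q^2)Y^3Z^2+(-6q^3-6q^2)Y^2Z^3,\\ a_3&=(-q^{10}-2q^9+11q^8-6q^7)YZ+(q^8+2q^7-8q^6+3q^5)YZ^2+(q^8+2q^7-5q^6-6q^5)Y^2Z\\ &\quad+(q^7+q^6-13q^5-4q^4+3q^3)Y^2Z^2+(-q^5-2q^4+4q^3+5q^2)Y^2Z^3\\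 &\quad+(-q^5-2q^4+5q^3+6q^2)Y^3Z^2+(q^3+2q^2+2q+1)Y^3Z^3. \end{aligned}$$
   Context: $\mathfrak{o}$ is a compact discrete valuation ring with uniformizer $\pi$ and residue field of cardinality $q$. $\mathfrak{o}^3$ carries componentwise multiplication; $\Lambda\le_s\mathfrak{o}^3$ means that $\Lambda$ is a finite-index $\mathfrak{o}$-submodule of $\mathfrak{o}^3$ closed under multiplication (not required to contain $(1,1,1)$). For $r_0\in\mathbb{Z}_{\ge0}$ and $r_1,r_2\in\mathbb{Z}_{\ge1}$ let $h_3(\{1,2\},r_0,(r_1,r_2))$ be the number of $\Lambda\le_s\mathfrak{o}^3$ with $\mathfrak{o}^3/\Lambda\cong\mathfrak{o}/\pi^{r_0+r_1+r_2}\mathfrak{o}\oplus\mathfrak{o}/\pi^{r_0+r_2}\mathfrak{o}\oplus\mathfrak{o}/\pi^{r_0}\mathfrak{o}$. Define $$\Xi_{3,\{1,2\}}(s_0,s_1,s_2)=\sum_{r_0\ge0}\ \sum_{r_1,r_2\ge1}h_3(\{1,2\},r_0,(r_1,r_2))\,q^{-3s_0r_0-s_1r_1-2s_2r_2}.$$ The identity is to be read as an identity of formal power series in $q^{-3s_0},q^{-s_1},q^{-2s_2}$ (equivalently, for real parts of $s_0,s_1,s_2$ sufficiently large). *)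

(* Defs.v *)
From HB Require Import structures.
From mathcomp Require Import all_boot all_order all_algebra.
From mathcomp Require Import generic_quotient ring_quotient finmap.
From mathcomp Require Import boolp classical_sets functions cardinality topology.

Set Implicit Arguments.
Unset Strict Implicit.
Unset Printing Implicit Defensive.

Import GRing.Theory.
Local Open Scope classical_set_scope.
Local Open Scope card_scope.
Local Open Scope ring_scope.

(** * Submodules and quotient modules *)

Record submodule (R : pzRingType) (V : lmodType R) := Submodule {
  submodule_pred :> {pred V};
  submodule_closed : submod_closed submodule_pred }.

Section Submodule.
Variables (R : pzRingType) (V : lmodType R).

(* Distinct terms of type [submodule V] are distinct subsets of [V], so
   counting such terms counts submodules. *)
Lemma submodule_eq (L M : submodule V) : L =i M -> L = M.
Proof.
case: L M => [L Lc] [M Mc] /= LM.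
have {}LM : L = M by apply/funext => x; exact: LM.
by case: _ / LM in Mc *; congr Submodule; exact: Prop_irrelevance.
Qed.

HB.instance Definition _ := gen_eqMixin (submodule V).
HB.instance Definition _ := gen_choiceMixin (submodule V).

HB.instance Definition _ (L : submodule V) :=
  GRing.isSubmodClosed.Build R V (submodule_pred L)
    (GRing.submod_closed_semi (submodule_closed L)).

End Submodule.

Section QuotientModule.
Local Open Scope quotient_scope.
Variables (R : pzRingType) (V : lmodType R) (L : submodule V).

Definition quotient_module := Quotient.quot (submodule_pred L).

HB.instance Definition _ := GRing.Zmodule.on quotient_module.
HB.instance Definition _ := EqQuotient.on quotient_module.

Definition quotient_scale (a : R) (x : quotient_module) : quotient_module :=
  \pi_quotient_module (a *: repr x).

Lemma quotient_piP (x y : V) :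
  (\pi_quotient_module x = \pi_quotient_module y) <-> (x - y \in L).
Proof. by rewrite Quotient.idealrBE; split=> /eqP. Qed.

Lemma quotient_piD (x y : V) :
  \pi_quotient_module (x + y) = \pi_quotient_module x + \pi_quotient_module y.
Proof. exact: Quotient.pi_add. Qed.

Lemma quotient_pi_scale (a : R) (x : V) :
  \pi_quotient_module (a *: x) = quotient_scale a (\pi_quotient_module x).
Proof.
apply/quotient_piP; rewrite -scalerBr rpredZ//.
by apply/quotient_piP; rewrite reprK.
Qed.

Let quotientP (x : quotient_module) : exists v, x = \pi_quotient_module v.
Proof. by exists (repr x); rewrite reprK. Qed.

Fact quotient_scaleA a b x :
  quotient_scale a (quotient_scale b x) = quotient_scale (a * b) x.
Proof.
have [v ->] := quotientP x.
by rewrite -(quotient_pi_scale b v) -(quotient_pi_scale a) -quotient_pi_scale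
  scalerA.
Qed.

Fact quotient_scale1 : left_id 1 quotient_scale.
Proof.
by move=> x; have [v ->] := quotientP x; rewrite -quotient_pi_scale scale1r.
Qed.

Fact quotient_scaleDr : right_distributive quotient_scale +%R.
Proof.
move=> a x y; have [v ->] := quotientP x; have [w ->] := quotientP y.
rewrite -quotient_piD -(quotient_pi_scale a v) -(quotient_pi_scale a w).
by rewrite -(quotient_pi_scale a (v + w)) scalerDr quotient_piD.
Qed.

Fact quotient_scaleDl x : {morph quotient_scale^~ x : a b / a + b}.
Proof.
move=> a b; have [v ->] := quotientP x.
rewrite -(quotient_pi_scale a v) -(quotient_pi_scale b v).
by rewrite -(quotient_pi_scale (a + b) v) scalerDl quotient_piD.
Qed.

HB.instance Definition _ := GRing.Zmodule_isLmodule.Build R quotient_module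
  quotient_scaleA quotient_scale1 quotient_scaleDr quotient_scaleDl.

End QuotientModule.

Definition isomorphic_modules (R : pzRingType) (M N : lmodType R) : Prop :=
  exists f : {linear M -> N}, bijective f.

(** * Compact discrete valuation rings *)

Section PrincipalIdeal.
Variables (R : comNzRingType) (a : R).

Definition principal_ideal_pred : {pred R^o} :=
  fun x => `[< exists b : R, x = b * a >].

Fact principal_ideal_closed : submod_closed principal_ideal_pred.
Proof.
split=> [|c x y /asboolP[b ->] /asboolP[d ->]]; apply/asboolP.
  by exists 0; rewrite mul0r.
by exists (c * b + d); rewrite mulrDl -mulrA.
Qed.

Definition principal_ideal : submodule R^o := Submodule principal_ideal_closed.

End PrincipalIdeal.

(* [o] is a principal ideal domain, not a field, whose nonunits form the
   ideal generated by [pi]; in particular it is local. *)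
Record dvr_with_uniformizer (o : idomainType) (pi : o) : Prop := {
  dvr_pid : forall I : submodule o^o, exists a : o, I = principal_ideal a;
  dvr_local : forall x : o, x \isn't a GRing.unit <-> x \in principal_ideal pi;
  dvr_not_field : pi != 0 }.

(* The ring [R] with the [pi]-adic topology *)
Definition adic (R : comNzRingType) (pi : R) : Type := R.

Section AdicTopology.
Variables (R : comNzRingType) (pi : R).

HB.instance Definition _ := Choice.copy (adic pi) R.

Definition adic_open (U : set (adic pi)) : Prop :=
  forall x : R, U x ->
    exists n : nat, forall y : R, y - x \in principal_ideal (pi ^+ n) -> U y.

Fact adic_openT : adic_open setT.
Proof. by move=> x _; exists 0%N. Qed.

Fact adic_openI : setI_closed adic_open.
Proof.
move=> U V oU oV x [/oU[m Um] /oV[n Vn]]; exists (m + n)%N => y.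
move=> /asboolP[b yx]; split; [apply: Um|apply: Vn]; apply/asboolP.
  by exists (b * pi ^+ n); rewrite yx exprD -mulrA [pi ^+ n * _]mulrC.
by exists (b * pi ^+ m); rewrite yx exprD mulrA.
Qed.

Fact adic_open_bigU (I : Type) (f : I -> set (adic pi)) :
  (forall i, adic_open (f i)) -> adic_open (\bigcup_i f i).
Proof.
by move=> of_ x [i _ /of_[n fn]]; exists n => y /fn fy; exists i.
Qed.

HB.instance Definition _ := isOpenTopological.Build (adic pi)
  adic_openT adic_openI adic_open_bigU.

End AdicTopology.

Record compact_dvr (o : idomainType) (pi : o) (q : nat) : Prop := {
  compact_dvr_uniformizer : dvr_with_uniformizer pi;
  compact_dvr_compact : compact [set: adic pi];
  compact_dvr_residue :
    [set: quotient_module (principal_ideal pi)] #= `I_q }.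

(** * The counting function *)

Section Counting.
Variables (o : idomainType) (pi : o).

(* Products in this type are componentwise. *)
Definition o3 := {ffun 'I_3 -> o^o}.

HB.instance Definition _ := GRing.PzRing.on o3.
HB.instance Definition _ := GRing.Lmodule.on o3.

Definition subalgebra (L : submodule o3) : Prop :=
  finite_set [set: quotient_module L]
  /\ (forall x y : o3, x \in L -> y \in L -> x * y \in L).

Definition cyclic_module (n : nat) : lmodType o :=
  quotient_module (principal_ideal (pi ^+ n)).

Definition subalgebras_of_type (r0 r1 r2 : nat) : set (submodule o3) :=
  [set L | subalgebra L /\
     isomorphic_modules (quotient_module L)
       (cyclic_module (r0 + r1 + r2) * cyclic_module (r0 + r2)
        * cyclic_module r0)%type].

(* [fset_set] is empty on infinite sets; the set here is finite, as its members
   all contain [pi ^+ (r0 + r1 + r2) *: o3], which has finite index. *)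
Definition h3 (r0 r1 r2 : nat) : nat :=
  #|` fset_set (subalgebras_of_type r0 r1 r2)|.

End Counting.

(** * Formal power series *)

Record fps (R : Type) := Fps { coefs : nat -> R }.

Section FpsRing.
Variable R : comNzRingType.
Implicit Types f g h : fps R.

HB.instance Definition _ := gen_eqMixin (fps R).
HB.instance Definition _ := gen_choiceMixin (fps R).

Lemma fpsP f g : coefs f =1 coefs g <-> f = g.
Proof.
by case: f g => [f] [g]; split=> [/funext /= ->|[->]].
Qed.

Definition fps_const (c : R) : fps R := Fps (fun n => if n == 0 then c else 0).
Definition fps_var : fps R := Fps (fun n => (n == 1)%:R).
Definition fps_add f g : fps R := Fps (fun n => coefs f n + coefs g n).
Definition fps_opp f : fps R := Fps (fun n => - coefs f n).
Definition fps_mul f g : fps R :=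
  Fps (fun n => \sum_(i < n.+1) coefs f i * coefs g (n - i)).

Fact fps_addA : associative fps_add.
Proof. by move=> f g h; apply/fpsP => n /=; rewrite addrA. Qed.
Fact fps_addC : commutative fps_add.
Proof. by move=> f g; apply/fpsP => n /=; rewrite addrC. Qed.
Fact fps_add0 : left_id (fps_const 0) fps_add.
Proof. by move=> f; apply/fpsP => n /=; rewrite if_same add0r. Qed.
Fact fps_addN : left_inverse (fps_const 0) fps_opp fps_add.
Proof. by move=> f; apply/fpsP => n /=; rewrite if_same addNr. Qed.

HB.instance Definition _ := GRing.isZmodule.Build (fps R)
  fps_addA fps_addC fps_add0 fps_addN.

Let trunc N f : {poly R} := \poly_(i < N.+1) coefs f i.

Let coef_trunc N f i : (i <= N)%N -> (trunc N f)`_i = coefs f i.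
Proof. by move=> iN; rewrite coef_poly ltnS iN. Qed.

Let coef_trunc_mul N f g i : (i <= N)%N ->
  coefs (fps_mul f g) i = (trunc N f * trunc N g)`_i.
Proof.
move=> iN; rewrite coefM /=; apply: eq_bigr => -[j /= ji] _.
by rewrite !coef_trunc ?(leq_trans _ iN) ?leq_subr// -ltnS.
Qed.

Fact fps_mulC : commutative fps_mul.
Proof.
by move=> f g; apply/fpsP => n; rewrite !(@coef_trunc_mul n)// mulrC.
Qed.

Fact fps_mulA : associative fps_mul.
Proof.
move=> f g h; apply/fpsP => n.
transitivity (trunc n f * (trunc n g * trunc n h))`_n.
  rewrite [RHS]coefM; apply: eq_bigr => i _.
  by rewrite coef_trunc ?leq_ord// (@coef_trunc_mul n)// leq_subr.
rewrite mulrA [LHS]coefM; apply: eq_bigr => i _.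
by rewrite coef_trunc ?leq_subr// -(@coef_trunc_mul n)// leq_ord.
Qed.

Fact fps_mul1 : left_id (fps_const 1) fps_mul.
Proof.
move=> f; apply/fpsP => n /=; rewrite big_ord_recl/= mul1r subn0.
by rewrite big1 ?addr0// => i _; rewrite mul0r.
Qed.

Fact fps_mulDl : left_distributive fps_mul fps_add.
Proof.
move=> f g h; apply/fpsP => n /=; rewrite -big_split/=.
by apply: eq_bigr => i _; rewrite mulrDl.
Qed.

Fact fps_oner_neq0 : fps_const 1 != 0 :> fps R.
Proof. by apply/eqP => -[/(congr1 (@^~ 0%N))/eqP]; rewrite oner_eq0. Qed.

HB.instance Definition _ := GRing.Zmodule_isComNzRing.Build (fps R)
  fps_mulA fps_mulC fps_mul1 fps_mulDl fps_oner_neq0.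

End FpsRing.

Section FpsUnitRing.
Variable R : comUnitRingType.
Implicit Types f g : fps R.

Definition fps_unit : {pred fps R} := fun f => coefs f 0 \is a GRing.unit.

(* With [c = (coefs f 0)^-1] and [v = 1 - c f], which has no constant term,
   the inverse of [f] is the geometric series [c * (1 + v + v^2 + ...)]. *)
Definition fps_inv f : fps R :=
  if f \in fps_unit then
    let c := (coefs f 0)^-1 in
    Fps (fun n => \sum_(k < n.+1) c * coefs ((1 - fps_const c * f) ^+ k) n)
  else f.

Let coefsM f g n :
  coefs (f * g) n = \sum_(i < n.+1) coefs f i * coefs g (n - i).
Proof. by []. Qed.

Let coefsCM c f n : coefs (fps_const c * f) n = c * coefs f n.
Proof.
rewrite coefsM big_ord_recl/= subn0 big1 ?addr0// => i _; exact: mul0r.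
Qed.

Let coefs_exp_lt (v : fps R) k n : coefs v 0 = 0 -> (n < k)%N -> coefs (v ^+ k) n = 0.
Proof.
move=> v0; elim: k n => [//|k IH] n nk; rewrite exprS coefsM.
rewrite big_ord_recl/= v0 mul0r add0r big1// => -[i /= i_n] _.
by rewrite IH ?mulr0//; case: n nk i_n => // n nk i_n; rewrite /bump/=; 
   rewrite add1n subSS (leq_ltn_trans (leq_subr _ _)).
Qed.

Let coefs_sum (I : Type) (s : seq I) (F : I -> fps R) n :
  coefs (\sum_(i <- s) F i) n = \sum_(i <- s) coefs (F i) n.
Proof.
elim: s => [|i s IH]; first by rewrite !big_nil /=; case: n.
by rewrite !big_cons -IH.
Qed.

Fact fps_mulV : {in fps_unit, left_inverse 1 fps_inv *%R}.
Proof.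
move=> f fU; rewrite /fps_inv fU; set c := (coefs f 0)^-1.
set v := 1 - fps_const c * f.
have v0 : coefs v 0 = 0 by rewrite /= [X in _ - X]coefsCM mulVr ?subrr.
apply/fpsP => N.
transitivity (coefs (fps_const c * (\sum_(k < N.+1) v ^+ k) * f) N).
  rewrite !coefsM; apply: eq_bigr => i _; congr (_ * _).
  rewrite coefsCM coefs_sum mulr_sumr.
  transitivity (\sum_(k < i.+1) c * coefs (v ^+ k) i); first by [].
  rewrite (big_ord_widen N.+1 (fun k : nat => c * coefs (v ^+ k) i))//.
  rewrite big_mkcond/=; apply: eq_bigr => k _.
  by case: ltnP => // ik; rewrite coefs_exp_lt ?mulr0.
rewrite mulrAC.
have -> : fps_const c * f = 1 - v by rewrite /v opprB addrC subrK.
have -> : (1 - v) * \sum_(k < N.+1) v ^+ k = 1 - v ^+ N.+1.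
  by rewrite -[in RHS](expr1n _ N.+1) subrXX; congr (_ * _);
    apply: eq_bigr => i _; rewrite expr1n mul1r.
by rewrite [LHS]/= coefs_exp_lt ?subr0.
Qed.

Fact fps_unitPl f g : g * f = 1 -> f \in fps_unit.
Proof.
move=> /fpsP/(_ 0); rewrite coefsM big_ord1/= => gf1.
by apply/unitrP; exists (coefs g 0); rewrite gf1 mulrC gf1.
Qed.

Fact fps_inv_out : {in [predC fps_unit], fps_inv =1 id}.
Proof. by move=> f; rewrite inE /fps_inv => /negbTE ->. Qed.

HB.instance Definition _ := GRing.ComNzRing_hasMulInverse.Build (fps R)
  fps_mulV fps_unitPl fps_inv_out.

Lemma fps_unitE f : (f \is a GRing.unit) = (coefs f 0 \is a GRing.unit).
Proof. by []. Qed.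

End FpsUnitRing.

(* Q[[T0, T1, T2]], where T0, T1, T2 stand for q^(-3 s0), q^(-s1), q^(-2 s2);
   T0 is the innermost variable. *)
Definition fps3 := fps (fps (fps rat)).
HB.instance Definition _ := GRing.ComUnitRing.on fps3.

Definition T0 : fps3 := fps_const (fps_const (fps_var rat)).
Definition T1 : fps3 := fps_const (fps_var _).
Definition T2 : fps3 := fps_var _.

Definition Xi (o : idomainType) (pi : o) : fps3 :=
  Fps (fun r2 => Fps (fun r1 => Fps (fun r0 =>
    if (0 < r1)%N && (0 < r2)%N then (h3 pi r0 r1 r2)%:R else 0))).

(** * The numerator *)

Section Numerator.
Variables (R : comNzRingType) (X Y Z q : R).

Definition a0 : R :=
  (4 * q ^+ 8 + 10 * q ^+ 7) + (8 * q ^+ 6 - 4 * q ^+ 5) * Y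
  - 18 * q ^+ 4 * Y * Z.

Definition a1 : R :=
  (q ^+ 10 + 8 * q ^+ 9 - 3 * q ^+ 8 - 10 * q ^+ 7)
  + (2 * q ^+ 8 - 11 * q ^+ 7 - q ^+ 6) * Z
  + (5 * q ^+ 8 - 20 * q ^+ 7 - 9 * q ^+ 6 + 4 * q ^+ 5) * Y
  + (- q ^+ 7 - 32 * q ^+ 6 + 6 * q ^+ 5 + 19 * q ^+ 4) * Y * Z
  + (- (6 * q ^+ 5) + 19 * q ^+ 4 + q ^+ 3) * Y * Z ^+ 2
  + (- (5 * q ^+ 5) + 12 * q ^+ 4 + 5 * q ^+ 3) * Y ^+ 2 * Z
  + (12 * q ^+ 3 + 5 * q ^+ 2 - q) * Y ^+ 2 * Z ^+ 2.

Definition a2 : R :=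
  (q ^+ 11 + q ^+ 10 - 6 * q ^+ 9)
  + (- q ^+ 9 - 7 * q ^+ 8 + 18 * q ^+ 7) * Y
  + (- q ^+ 9 - 4 * q ^+ 8 + 9 * q ^+ 7) * Z
  + (- (14 * q ^+ 8) + 5 * q ^+ 7 + 32 * q ^+ 6 - 5 * q ^+ 5) * Y * Z
  + (11 * q ^+ 6 + 6 * q ^+ 5 - 17 * q ^+ 4) * Y * Z ^+ 2
  + (8 * q ^+ 6 + 14 * q ^+ 5 - 10 * q ^+ 4 - 4 * q ^+ 3) * Y ^+ 2 * Z
  + (13 * q ^+ 5 + 2 * q ^+ 4 - 18 * q ^+ 3 - 7 * q ^+ 2) * Y ^+ 2 * Z ^+ 2
  + (- (7 * q ^+ 3) - 7 * q ^+ 2) * Y ^+ 3 * Z ^+ 2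
  + (- (6 * q ^+ 3) - 6 * q ^+ 2) * Y ^+ 2 * Z ^+ 3.

Definition a3 : R :=
  (- q ^+ 10 - 2 * q ^+ 9 + 11 * q ^+ 8 - 6 * q ^+ 7) * Y * Z
  + (q ^+ 8 + 2 * q ^+ 7 - 8 * q ^+ 6 + 3 * q ^+ 5) * Y * Z ^+ 2
  + (q ^+ 8 + 2 * q ^+ 7 - 5 * q ^+ 6 - 6 * q ^+ 5) * Y ^+ 2 * Z
  + (q ^+ 7 + q ^+ 6 - 13 * q ^+ 5 - 4 * q ^+ 4 + 3 * q ^+ 3)
    * Y ^+ 2 * Z ^+ 2
  + (- q ^+ 5 - 2 * q ^+ 4 + 4 * q ^+ 3 + 5 * q ^+ 2) * Y ^+ 2 * Z ^+ 3
  + (- q ^+ 5 - 2 * q ^+ 4 + 5 * q ^+ 3 + 6 * q ^+ 2) * Y ^+ 3 * Z ^+ 2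
  + (q ^+ 3 + 2 * q ^+ 2 + 2 * q + 1) * Y ^+ 3 * Z ^+ 3.

Definition numerator : R := a0 + a1 * X + a2 * X ^+ 2 + a3 * X ^+ 3.

End Numerator.

(* Main.v *)
(* A submodule of the given type is pi^r0 times a lattice M with a Hermite
   normal form: for a unique order (c1, c2, c3) of the coordinate axes and
   unique residues x, y, g, the lattice M is spanned by v = e_c1 + x e_c2 + y
   e_c3, by pi^r2 w with w = e_c3 - g e_c2, and by pi^(r1+r2) e_c2. Closure
   under products only has to be tested on v^2, vw and w^2, and amounts to four
   congruences in x, y and g. Where y^2 - y is a unit the main congruence,
   which comes from v^2 and is linear in g, is solved for g; elsewhere Hensel's
   lemma solves it for x, and there remains a sum over the valuation of y or y
   - 1. The resulting piecewise exponential function of (r0, r1, r2) is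
   multiplicative along the edges of a subdivision of the orthant into cones,
   so that every cone contributes a product of geometric series; adding them up
   leaves an identity between rational functions. *)

Require Import Defs.
From HB Require Import structures.
From Stdlib Require Import ZArith Ring_polynom Ring_theory InitialRing.
From mathcomp Require Import all_boot all_order all_algebra.
From mathcomp Require Import generic_quotient ring_quotient finmap.
From mathcomp Require Import boolp classical_sets functions cardinality
  topology.
From mathcomp Require Import zify ssrZ.
From mathcomp.algebra_tactics Require common.

Set Implicit Arguments.
Unset Strict Implicit.
Unset Printing Implicit Defensive.

Import Order.TTheory GRing.Theory Num.Theory.
Local Open Scope quotient_scope.
Local Open Scope ring_scope.

(** Closure under products does not see the order of the axes: the four congruences involve only
    [x], [y], [g]. The order only decides which of [x], [y], [g] must lie in the maximal ideal for
    the normal form to be unique. So the six orders merge into one weight depending on the residues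
    of [x], [y], [g], and a single triple sum remains. The obstacle is that the congruences have
    four different moduli, some of them void, and are coupled through [g (y^2 - y)]. The
    factorisation [x^2 - x - (y^2 - y) = (x - y) (x + y - 1)] decouples them: modulo the main
    congruence, [(x + y - 1) g (y - x)] equals [g (g + 1) (y^2 - y)]. When [x] and [y] share the
    residue 0 or 1, [x] drops out of the other conditions; when their residues are 0 and 1 in some
    order, [y - x] is a unit and [g] itself is forced to be divisible. Both residues are handled at
    once by an idempotent [e], for which [2 e - 1] is a unit in every residue characteristic. Sums
    take values in a commutative ring because factors such as [q - 2] occur. *)

Section CommutativeRingIdentities.
Variable R : comPzRingType.

(** * Polynomial identities by reflection *)

Definition ring_eval (l : seq R) (e : PExpr Z) : R :=
  PEeval 0 1 +%R *%R (fun x y => x - y) -%R (fun n : Z => (int_of_Z n)%:~R) id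
    (fun x n => x ^+ nat_of_N n) l e.

Definition ring_norm (e : PExpr Z) : Pol Z :=
  norm_subst Z0 (Zpos xH) Z.add Z.mul Z.sub Z.opp Z.eqb
    (triv_div Z0 (Zpos xH) Z.eqb) 0 [::] e.

Lemma ring_normP (l : seq R) (e1 e2 : PExpr Z) :
  Ring_polynom.Peq Z.eqb (ring_norm e1) (ring_norm e2) = true ->
  ring_eval l e1 = ring_eval l e2.
Proof.
pose RE := Eq_ext (+%R : R -> R -> R) *%R -%R.
pose AR := Rth_ARth (Eqsth R) RE (common.RR R).
have := @ring_correct _ _ _ _ _ _ _ _ (Eqsth R) RE AR _ _ _ _ _ _ _ _ _
  (common.RZ R) _ _ _ (common.PN R) _ (triv_div_th (Eqsth R) RE AR
    (common.RZ R)).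
by move=> /(_ 0%N l [::] e1 e2 I).
Qed.

End CommutativeRingIdentities.

Ltac nat_literal n :=
  lazymatch n with
  | O => constr:(true)
  | S ?m => nat_literal m
  | nat_of_bool true => constr:(true)
  | nat_of_bool false => constr:(true)
  | _ => constr:(false)
  end.

Ltac atom_index t l :=
  lazymatch l with
  | ?u :: ?l' =>
    match constr:(Set) with
    | _ => let _ := match constr:(Set) with _ => constr_eq t u end in
           constr:(xH)
    | _ => let i := atom_index t l' in
           let j := eval compute in (Pos.succ i) in constr:(j)
    end
  end.

Ltac add_atom t l :=
  match constr:(Set) with
  | _ => let _ := atom_index t l in l
  | _ => constr:(t :: l)
  end.

Ltac ring_atoms l t :=
  lazymatch t with
  | (?a + ?b)%R => let l := ring_atoms l a in ring_atoms l b
  | (?a * ?b)%R => let l := ring_atoms l a in ring_atoms l b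
  | (- ?a)%R => ring_atoms l a
  | 0%R => l
  | 1%R => l
  | (1 *+ ?n)%R =>
    lazymatch nat_literal n with true => l | _ => add_atom t l end
  | (?a ^+ ?n)%R =>
    lazymatch nat_literal n with true => ring_atoms l a | _ => add_atom t l end
  | _ => add_atom t l
  end.

Ltac ring_reify l t :=
  lazymatch t with
  | (?a + ?b)%R =>
    let a := ring_reify l a in let b := ring_reify l b in
    constr:(PEadd a b)
  | (?a * ?b)%R =>
    let a := ring_reify l a in let b := ring_reify l b in
    constr:(PEmul a b)
  | (- ?a)%R => let a := ring_reify l a in constr:(PEopp a)
  | 0%R => constr:(@PEO Z)
  | 1%R => constr:(@PEI Z)
  | (1 *+ ?n)%R =>
    lazymatch nat_literal n with
    | true => let v := eval compute in (Z.of_nat n) in constr:(PEc v)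
    | _ => let i := atom_index t l in constr:(@PEX Z i)
    end
  | (?a ^+ ?n)%R =>
    lazymatch nat_literal n with
    | true =>
      let v := eval compute in (N.of_nat n) in
      let a := ring_reify l a in constr:(PEpow a v)
    | _ => let i := atom_index t l in constr:(@PEX Z i)
    end
  | _ => let i := atom_index t l in constr:(@PEX Z i)
  end.

(* A substitute for [mathcomp.algebra_tactics.ring], whose universe constraints
   are inconsistent with those of [Defs]. *)
Ltac comring :=
  intros;
  lazymatch goal with
  | |- @eq ?T ?a ?b =>
    let l := ring_atoms (@nil T) a in
    let l := ring_atoms l b in
    let e1 := ring_reify l a in
    let e2 := ring_reify l b in
    refine (@ring_normP _ l e1 e2 _); vm_compute; reflexivity
  end.

Section QuotientIsomorphism.
Variables (R : pzRingType) (V W : lmodType R) (L : submodule V).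
Local Notation pi_L := (\pi_(quotient_module L)).

Lemma pi_reprP (v : V) : repr (pi_L v) - v \in L.
Proof. by apply: (quotient_piP L _ _).1; rewrite reprK. Qed.

Lemma quotient_pi0 : pi_L 0 = 0.
Proof. by apply: (addIr (pi_L 0)); rewrite -(quotient_piD L) !add0r. Qed.

(** First isomorphism theorem, used in both directions to trade the quotient type for a linear map
    on [V], so that the type of a sublattice of [o3] is read off from three linear forms. *)
Lemma isomorphic_quotientP :
  isomorphic_modules (quotient_module L) W <->
  exists phi : {linear V -> W},
    (forall w, exists v, phi v = w) /\ (forall v, phi v = 0 <-> v \in L).
Proof.
split=> [[f [g fK gK]]|[phi [phi_surj phiL]]].
  pose psi v : W := f (pi_L v).
  have psi_lin : linear psi.
    move=> a u v; rewrite /psi (quotient_piD L) (quotient_pi_scale L).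
    exact: linearP.
  pose psiL : {linear V -> W} := HB.pack psi (GRing.isLinear.Build _ _ _ _ psi
    psi_lin).
  exists psiL; split=> [w|v] /=.
    by exists (repr (g w)); rewrite /psi reprK gK.
  rewrite /psi -[v in v \in L]subr0 -(quotient_piP L) quotient_pi0.
  by split=> [|->]; [rewrite -(linear0 f) => /(can_inj fK)|exact: linear0].
pose f (x : quotient_module L) : W := phi (repr x).
have f_pi v : f (pi_L v) = phi v.
  by apply/eqP; rewrite -subr_eq0 -linearB; apply/eqP/phiL/pi_reprP.
have f_lin : linear f.
  move=> a x y; rewrite -[x in LHS]reprK -[y in LHS]reprK.
  have -> : a *: pi_L (repr x) + pi_L (repr y) = pi_L (a *: repr x + repr y).
    by rewrite (quotient_piD L) (quotient_pi_scale L).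
  by rewrite f_pi linearP.
pose fL : {linear quotient_module L -> W} :=
  HB.pack f (GRing.isLinear.Build _ _ _ _ f f_lin).
have [g gP] := choice phi_surj.
exists fL; exists (fun w => pi_L (g w)) => [x|w] /=.
  rewrite -[RHS]reprK; apply/(quotient_piP L)/phiL.
  by rewrite linearB gP subrr.
by rewrite f_pi gP.
Qed.

End QuotientIsomorphism.

(** * Residue classes modulo powers of the uniformizer *)

Section CompactDvr.
Variables (o : idomainType) (pi : o).

Definition dvp (k : nat) (x : o) : bool := x \in principal_ideal (pi ^+ k).

Arguments dvp : simpl never.

Lemma dvpP k x : reflect (exists b, x = b * pi ^+ k) (dvp k x).
Proof. exact: asboolP. Qed.

Lemma dvp0 x : dvp 0 x.
Proof. by apply/dvpP; exists x; rewrite expr0 mulr1. Qed.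

Lemma dvp_0 k : dvp k 0.
Proof. by apply/dvpP; exists 0; rewrite mul0r. Qed.

Lemma dvpD k x y : dvp k x -> dvp k y -> dvp k (x + y).
Proof.
by move=> /dvpP[b ->] /dvpP[c ->]; apply/dvpP; exists (b + c); rewrite mulrDl.
Qed.

Lemma dvpMl k c x : dvp k x -> dvp k (c * x).
Proof. by move=> /dvpP[b ->]; apply/dvpP; exists (c * b); rewrite mulrA. Qed.

Lemma dvpMr k c x : dvp k x -> dvp k (x * c).
Proof. by rewrite mulrC; exact: dvpMl. Qed.

Lemma dvpN k x : dvp k (- x) = dvp k x.
Proof.
by apply/idP/idP => /(dvpMl (-1)); rewrite mulN1r ?opprK.
Qed.

Lemma dvpB k x y : dvp k x -> dvp k y -> dvp k (x - y).
Proof. by move=> xk yk; rewrite dvpD ?dvpN. Qed.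

Lemma dvp_distC k x y : dvp k (x - y) = dvp k (y - x).
Proof. by rewrite -dvpN opprB. Qed.

Lemma dvpDr k x y : dvp k y -> dvp k (x + y) = dvp k x.
Proof.
move=> yk; apply/idP/idP => [xyk|xk]; last exact: dvpD.
by rewrite -[x](addrK y) dvpB.
Qed.

Lemma dvp_congr k x y : dvp k (x - y) -> dvp k x = dvp k y.
Proof. by move=> xy; rewrite -[x](subrK y) addrC dvpDr. Qed.

Lemma dvp_unit k u x : u \is a GRing.unit -> dvp k (u * x) = dvp k x.
Proof.
move=> uU; apply/idP/idP => [/(dvpMl u^-1)|]; last exact: dvpMl.
by rewrite mulKr.
Qed.

Lemma dvp_exp j k : (j <= k)%N -> dvp j (pi ^+ k).
Proof.
by move=> jk; apply/dvpP; exists (pi ^+ (k - j)); rewrite -exprD subnK.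
Qed.

Lemma dvp_le j k x : (j <= k)%N -> dvp k x -> dvp j x.
Proof. by move=> jk /dvpP[b ->]; rewrite dvpMl// dvp_exp. Qed.

Hypothesis dvr : dvr_with_uniformizer pi.

Lemma pi_neq0 : pi != 0.
Proof. exact: dvr_not_field dvr. Qed.

Lemma dvp1E x : dvp 1 x = (x \isn't a GRing.unit).
Proof.
by rewrite /dvp expr1; apply/idP/idP => /(dvr_local dvr).
Qed.

Lemma dvp_cancel m k x : dvp (m + k) (pi ^+ m * x) = dvp k x.
Proof.
apply/dvpP/dvpP => -[b].
  rewrite exprD mulrCA => /(mulfI (expf_neq0 m pi_neq0)) ->.
  by exists b.
by move=> ->; exists b; rewrite exprD mulrCA.
Qed.

Lemma dvp_expM k n x : dvp k (pi ^+ n * x) = dvp (k - n) x.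
Proof.
have [kn|/ltnW nk] := leqP k n; last by rewrite -{1}(subnKC nk) dvp_cancel.
have -> : (k - n = 0)%N by apply/eqP.
by rewrite dvp0 dvpMr// dvp_exp.
Qed.

Lemma dvp_expS k x : dvp k.+1 (pi * x) = dvp k x.
Proof. by rewrite -[RHS](dvp_cancel 1) expr1. Qed.

Lemma dvp1M x y : dvp 1 (x * y) = dvp 1 x || dvp 1 y.
Proof. by rewrite !dvp1E unitrM negb_and. Qed.

Lemma dvp1_1 : dvp 1 1 = false.
Proof. by rewrite dvp1E unitr1. Qed.

Lemma dvp_exp_pi j k : dvp j (pi ^+ k) = (j <= k)%N.
Proof.
rewrite -[pi ^+ k]mulr1 dvp_expM; case: leqP => jk.
  by move: jk; rewrite -subn_eq0 => /eqP ->; rewrite dvp0.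
apply/negbTE/negP => /(@dvp_le 1); rewrite subn_gt0 jk dvp1_1.
by move=> /(_ isT).
Qed.

Lemma unit_of_dvp1 x y : dvp 1 (x - y) ->
  (x \is a GRing.unit) = (y \is a GRing.unit).
Proof. by move=> /dvp_congr; rewrite !dvp1E => /(congr1 negb); rewrite !negbK.
Qed.

(** * Systems of representatives and sums over them *)

Definition digits : seq o :=
  [seq repr c | c <- fset_set [set: quotient_module (principal_ideal pi)]].

(** Truncated expansions in powers of [pi], lowest digit outermost. Working with elements of [o]
    instead of classes lets congruences modulo different powers of [pi] be tested on the same
    representative. *)
Fixpoint reps (k : nat) : seq o :=
  if k is k'.+1 then [seq d + pi * x | d <- digits, x <- reps k'] else [:: 0].

Variable q : nat.
Hypothesis residue : ([set: quotient_module (principal_ideal pi)] #= `I_q)%card.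

Let residue_finite : finite_set [set: quotient_module (principal_ideal pi)].
Proof. by apply/finite_setP; exists q. Qed.

Lemma size_digits : size digits = q.
Proof.
by rewrite size_map; exact: card_fset_set residue.
Qed.

Lemma digits_inj x y : x \in digits -> y \in digits -> dvp 1 (x - y) -> x = y.
Proof.
move=> /mapP[c _ ->] /mapP[d _ ->]; rewrite /dvp expr1.
move=> /(quotient_piP (principal_ideal pi) (repr c) (repr d)).2.
by rewrite !reprK => ->.
Qed.

Lemma digits_rep x : exists2 d, d \in digits & dvp 1 (x - d).
Proof.
exists (repr (\pi_(quotient_module (principal_ideal pi)) x)).
  by apply: map_f; rewrite in_fset_set ?inE.
rewrite /dvp expr1; apply: (quotient_piP (principal_ideal pi) x (repr _)).1.
by rewrite reprK.
Qed.

Lemma uniq_digits : uniq digits.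
Proof.
rewrite map_inj_uniq ?fset_uniq// =>
  c d /(congr1 \pi_(quotient_module (principal_ideal pi))).
by rewrite !reprK.
Qed.

Lemma q_gt1 : (1 < q)%N.
Proof.
have [d0 d0d d0P] := digits_rep 0; have [d1 d1d d1P] := digits_rep 1.
rewrite -size_digits; apply: (@leq_trans (size [:: d0; d1])) => //.
apply: uniq_leq_size => /=; last by move=> x /[!inE] /orP[]/eqP ->.
rewrite andbT inE; apply/eqP => d01; move: d0P d1P.
rewrite d01 dvp_distC subr0 => d1_0 /dvp_congr.
by rewrite d1_0 dvp1_1.
Qed.

Lemma size_reps k : size (reps k) = (q ^ k)%N.
Proof. by elim: k => //= k IH; rewrite size_allpairs size_digits IH -expnS. Qed.

Lemma reps_rep k x : exists2 r, r \in reps k & dvp k (x - r).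
Proof.
elim: k x => [|k IH] x; first by exists 0; rewrite ?dvp0 ?mem_seq1.
have [d dd /dvpP[y xdy]] := digits_rep x; have [r rk yr] := IH y.
exists (d + pi * r); first by apply: allpairs_f.
by rewrite opprD addrA xdy expr1 mulrC -mulrBr dvp_expS.
Qed.

Lemma reps_inj k x y : x \in reps k -> y \in reps k -> dvp k (x - y) -> x = y.
Proof.
elim: k x y => [|k IH] x y /=; first by rewrite !inE => /eqP -> /eqP ->.
move=> /allpairsP[[c r] /= [cd rk ->]] /allpairsP[[d s] /= [dd sk ->]].
rewrite opprD addrACA -mulrBr => crds.
have cd1 : c = d.
  have := dvp_le (ltn0Sn k) crds; rewrite dvpDr ?dvp_expS ?dvp0//.
  exact: digits_inj.
by move: crds; rewrite cd1 subrr add0r dvp_expS => /IH -> .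
Qed.

Lemma uniq_reps k : uniq (reps k).
Proof.
elim: k => //= k IH; apply: allpairs_uniq; rewrite ?uniq_digits//.
move=> [c r] [d s] /allpairsP[[c' r'] /= [cd rk [-> ->]]].
move=> /allpairsP[[d' s'] /= [dd sk [-> ->]]] /eqP.
rewrite -subr_eq0 opprD addrACA -mulrBr => /eqP e.
have cd1 : c' = d'.
  apply: digits_inj => //; rewrite -(@dvpDr 1 _ (pi * (r' - s'))) ?e ?dvp_0//.
  by rewrite dvp_expS dvp0.
move/eqP: e; rewrite cd1 subrr add0r mulf_eq0 (negbTE pi_neq0)/= subr_eq0.
by move=> /eqP ->.
Qed.

Definition rep k x : o := xget 0 [set r | r \in reps k /\ dvp k (x - r)].

Lemma repP k x : rep k x \in reps k /\ dvp k (x - rep k x).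
Proof. 
have [r rk xr] := reps_rep k x.
by apply: (@xgetPex _ 0 [set r | r \in reps k /\ dvp k (x - r)]); exists r.
Qed.

Variable K : comNzRingType.

Definition periodic k (F : o -> K) := forall x y, dvp k (x - y) -> F x = F y.

(** Composed with [rep k], the map [phi] becomes an injection of the finite list [reps k] into
    itself, hence a permutation of it. *)
Lemma sum_reps_bij k (phi : o -> o) F : periodic k F ->
  (forall x y, dvp k (phi x - phi y) -> dvp k (x - y)) ->
  \sum_(x <- reps k) F (phi x) = \sum_(x <- reps k) F x.
Proof.
move=> Fk phi_inj.
transitivity (\sum_(y <- [seq rep k (phi x) | x <- reps k]) F y).
  by rewrite big_map; apply: eq_bigr => x _; apply: Fk; case: (repP k (phi x)).
apply: perm_big.
have u : uniq [seq rep k (phi x) | x <- reps k].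
  rewrite map_inj_in_uniq ?uniq_reps// => x y xk yk xy.
  apply: (reps_inj xk yk); apply: phi_inj.
  have [_ /dvpD Dx] := repP k (phi x); have [_ Dy] := repP k (phi y).
  by move: (dvpB (repP k (phi x)).2 Dy); rewrite xy opprB addrA subrK.
apply: uniq_perm => //; first exact: uniq_reps.
have sub : {subset [seq rep k (phi x) | x <- reps k] <= reps k}.
  by move=> _ /mapP[x _ ->]; case: (repP k (phi x)).
by case: (uniq_min_size u sub); rewrite ?size_map.
Qed.

Lemma sum_reps_add m k F :
  \sum_(x <- reps (m + k)) F x =
  \sum_(c <- reps m) \sum_(x <- reps k) F (c + pi ^+ m * x) :> K.
Proof.
elim: m F => [|m IH] F.
  by rewrite big_seq1; apply: eq_bigr => x _; rewrite expr0 mul1r add0r.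
rewrite addSn /= !big_allpairs_dep/=; apply: eq_bigr => d _; rewrite IH.
apply: eq_bigr => c _; apply: eq_bigr => x _; congr F; rewrite exprS; comring.
Qed.

Arguments reps : simpl never.

Lemma sum_reps_class m k c F : periodic (m + k) F ->
  \sum_(x <- reps (m + k) | dvp m (x - c)) F x =
  \sum_(x <- reps k) F (c + pi ^+ m * x).
Proof.
move=> Fmk; rewrite big_mkcond sum_reps_add.
have [ck cc] := repP m c; rewrite (bigD1_seq (rep m c)) ?uniq_reps//=.
rewrite [X in _ + X]big_seq_cond [X in _ + X]big1 ?addr0 =>
  [|d /andP[dk dc]]; last first.
  rewrite big1// => x _; case: ifP => // dcx; case/eqP: dc.
  apply: (reps_inj dk ck); move: (dvpD dcx cc).
  have -> : d + pi ^+ m * x - c + (c - rep m c) = d - rep m c + pi ^+ m * x.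
    by comring.
  by rewrite dvpDr// dvpMr// dvp_exp.
(* The chosen representative of the class of [c] differs from [c] by [t * pi ^+ m]; translation by
   [t] in the inner sum absorbs the difference. *)
have /dvpP[t ct] := cc.
have ph x y : dvp k (x - t - (y - t)) -> dvp k (x - y)
  by rewrite opprB addrA subrK.
rewrite -[RHS](@sum_reps_bij _ (fun x => x - t)) => [||//].
  apply: eq_bigr => x _.
  have -> : rep m c + pi ^+ m * x = c + pi ^+ m * (x - t).
    by rewrite mulrBr [_ * t]mulrC -ct; comring.
  by rewrite ifT// addrAC subrr add0r dvpMr// dvp_exp.
by move=> x y xy; apply: Fmk; rewrite opprD addrACA subrr add0r -mulrBr
  dvp_cancel.
Qed.

Local Notation Q := (q%:R : K).

Lemma sum_reps_1 k : \sum_(x <- reps k) (1 : K) = Q ^+ k.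
Proof. by rewrite big_const_seq count_predT size_reps iter_addr_0 natrX. Qed.

Lemma count_class m k c : (m <= k)%N ->
  \sum_(x <- reps k | dvp m (x - c)) 1 = Q ^+ (k - m).
Proof.
by move=> /subnKC {1}<-; rewrite (@sum_reps_class m _ c (fun=> 1)) ?sum_reps_1.
Qed.

(** For [i <= k], the number of classes modulo [pi ^+ k] of valuation [k - i], the zero class being
    [i = 0]. Counting valuations from the top makes this independent of [k]. *)
Definition valuation_weight (i : nat) : K :=
  if i is i'.+1 then (Q - 1) * Q ^+ i' else 1.

(** Each class is a unit times a power of [pi]. The units form the last term; the multiples of [pi]
    are the same sum one level down. *)
Lemma sum_reps_valuation k F : periodic k F ->
  (forall u t, u \is a GRing.unit -> F (u * t) = F t) ->
  \sum_(t <- reps k) F t =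
  \sum_(i < k.+1) valuation_weight i * F (pi ^+ (k - i)).
Proof.
elim: k F => [|k IH] F Fk Fu.
  rewrite big_ord1 big_seq1 mul1r; apply: Fk.
  exact: dvp0.
rewrite (bigID (fun t => dvp 1 (t - 0)))/= (@sum_reps_class 1 k)//.
rewrite (IH (fun x => F (0 + pi ^+ 1 * x))); last 2 first.
- by move=> x y xy; apply: Fk; rewrite !add0r -mulrBr expr1 dvp_expS.
- by move=> u t uU; rewrite !add0r mulrCA Fu.
rewrite [RHS]big_ord_recr/= subnn; congr (_ + _).
  apply: eq_bigr => i _; rewrite add0r -exprD add1n subSn//.
  exact: leq_ord.
transitivity (\sum_(t <- reps k.+1 | ~~ dvp 1 (t - 0)) F 1).
  apply: eq_bigr => t; rewrite subr0 dvp1E negbK => tU.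
  by rewrite -[t]mulr1 Fu// expr0.
under eq_bigr do rewrite -[F 1]mul1r; rewrite -mulr_suml expr0; congr (_ * _).
have := sum_reps_1 k.+1; rewrite (bigID (fun t => dvp 1 (t - 0)))/=
  count_class// subn1/=.
by move=> /(canRL (addKr _)) ->; rewrite exprS; comring.
Qed.

(** It is its own inverse. This is the derivative of [x^2 - x] at [e], so both roots are simple
    modulo [pi], also in residue characteristic two. *)
Lemma idempotent_unit (e : o) : e ^+ 2 = e -> 2 * e - 1 \is a GRing.unit.
Proof.
move=> ee; apply/unitrP; exists (2 * e - 1).
suff : (2 * e - 1) * (2 * e - 1) = 1 by [].
have -> : (2 * e - 1) * (2 * e - 1) = 4 * (e ^+ 2 - e) + 1 by comring.
by rewrite ee subrr mulr0 add0r.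
Qed.

(* On a class [e + (pi)] the polynomial [x^2 - x + c] is injective modulo every
   power of [pi], because [x + x' - 1] is a unit there; by finiteness it is
   onto, which replaces completeness in Hensel's lemma. *)
Lemma count_hensel N k e c : e ^+ 2 = e -> dvp 1 c -> (0 < k <= N)%N ->
  \sum_(x <- reps N | dvp 1 (x - e) && dvp k (x ^+ 2 - x + c)) 1 = Q ^+ (N - k).
Proof.
move=> ee /dvpP[c' c1]; case: k => // k; case: N => // N /= kN.
rewrite big_mkcondr/= (@sum_reps_class 1 N e
  (fun x => if dvp k.+1 (x ^+ 2 - x + c) then 1 else 0)); last first.
  move=> x y xy; congr (if _ then _ else _); apply: dvp_congr.
  apply: dvp_le kN _.
  have -> : x ^+ 2 - x + c - (y ^+ 2 - y + c) = (x - y) * (x + y - 1)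
    by comring.
  exact: dvpMr.
pose phi x := pi * x ^+ 2 + (2 * e - 1) * x + c'.
pose F x : K := if dvp k x then 1 else 0.
transitivity (\sum_(x <- reps N) F (phi x)).
  apply: eq_bigr => x _; rewrite c1 expr1.
  have -> : (e + pi * x) ^+ 2 - (e + pi * x) + c' * pi
          = e ^+ 2 - e + pi * phi x by rewrite /phi; comring.
  by rewrite ee subrr add0r dvp_expS.
rewrite sum_reps_bij.
- rewrite -big_mkcond/= subSS -(@count_class k N 0)//.
  by apply: eq_bigl => x; rewrite subr0.
- by move=> x y xy; rewrite /F (dvp_congr (@dvp_le k N _ kN xy)).
move=> x y; have -> : phi x - phi y = (pi * (x + y) + (2 * e - 1)) * (x - y).
  by rewrite /phi; comring.
rewrite dvp_unit// (@unit_of_dvp1 _ (2 * e - 1)) ?idempotent_unit//.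
by rewrite addrK -[pi]expr1 dvpMr// dvp_exp.
Qed.

(* The conditions on the code [(x, y, g)] for [pi^n M] to be closed under
   products, where [M] is spanned by [v = (1, x, y)], [pi^b w] with [w = (0,
   -g, 1)], and [pi^(a+b) (0, 1, 0)]. The first two come from [v^2], the third
   from [v w], the last from [w^2]. Subtractions are truncated: a condition
   modulo a nonpositive power of [pi] is void. *)
Definition closed_code n a b x y g :=
  [&& dvp (b - n) (y ^+ 2 - y),
      dvp (a + b - n) (x ^+ 2 - x + g * (y ^+ 2 - y)),
      dvp (a - n) (g * (y - x)) &
      dvp (a - (n + b)) (g * (g + 1))].

Definition nonunit (x : o) : K := (dvp 1 x)%:R.

(* The number of axis orders for which the code is admissible; see
   [sum_admissible]. *)
Definition multiplicity x y g : K :=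
  1 + nonunit g + nonunit y + nonunit x * nonunit g + nonunit x * nonunit y
  + nonunit x * nonunit y * nonunit g.

(** * Codes with y congruent to 0 or 1 *)

Lemma nonunit_congr x y : dvp 1 (x - y) -> nonunit x = nonunit y.
Proof. by rewrite /nonunit => /dvp_congr ->. Qed.

(** Modulo [pi] the main congruence reads [x^2 = x], so [x] is congruent to [e] or to [1 - e], and
    on each class Hensel counting gives [Q ^+ n] solutions. On the first, [x + y - 1] is a unit and
    the third congruence becomes one on [g (g + 1) (y^2 - y)]. On the second, [y - x] is a unit, the
    third congruence says that [pi ^+ (a - n)] divides [g], and the fourth follows. *)
Lemma sum_code_nonunit n a b y g e : e ^+ 2 = e -> dvp 1 (y - e) ->
  (n < a + b)%N -> dvp (b - n) (y ^+ 2 - y) ->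
  \sum_(x <- reps (a + b) | closed_code n a b x y g) multiplicity x y g =
  Q ^+ n *
    (multiplicity e e g *
       (dvp (a - n) (g * (g + 1) * (y ^+ 2 - y)) && dvp (a - (n + b)) (g * (g +
         1)))%:R
     + multiplicity (1 - e) e g * (dvp (a - n) g)%:R).
Proof.
move=> ee ye nab iy.
have k0 : (0 < a + b - n)%N by rewrite subn_gt0.
have kan : (a - n <= a + b - n)%N by lia.
have y1 : dvp 1 (y ^+ 2 - y).
  have -> : y ^+ 2 - y = (y - e) * (y + e - 1) + (e ^+ 2 - e) by comring.
  by rewrite ee subrr addr0 dvpMr.
have gy1 : dvp 1 (g * (y ^+ 2 - y)) by rewrite dvpMl.
have cnt f : f ^+ 2 = f -> \sum_(x <- reps (a + b) | dvp 1 (x - f) &&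
    dvp (a + b - n) (x ^+ 2 - x + g * (y ^+ 2 - y))) 1 = Q ^+ n.
  move=> ff; rewrite count_hensel ?k0 ?leq_subr//; congr (_ ^+ _); lia.
have e1 : (1 - e) ^+ 2 = 1 - e.
  have -> : (1 - e) ^+ 2 = 1 - e + (e ^+ 2 - e) by comring.
  by rewrite ee subrr addr0.
have D1 : dvp 1 (2 * e - 1) = false by rewrite dvp1E idempotent_unit.
rewrite (bigID (fun x => dvp 1 (x - e)))/= mulrDr; congr (_ + _).
  set P := _ && dvp (a - (n + b)) _.
  transitivity (\sum_(x <- reps (a + b) | dvp 1 (x - e) &&
    dvp (a + b - n) (x ^+ 2 - x + g * (y ^+ 2 - y))) (multiplicity e e g *
      P%:R)).
    rewrite big_mkcond [RHS]big_mkcond/=; apply: eq_bigr => x _.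
    rewrite /closed_code iy andbC/=; case: (boolP (dvp 1 (x - e))) => //= xe.
    case: (boolP (dvp (a + b - n) _)) => //= kx.
    have -> : dvp (a - n) (g * (y - x)) = dvp (a - n) (g * (g + 1) * (y ^+
      2 - y)).
      have U : x + y - 1 \is a GRing.unit.
        rewrite -[_ \is a _]negbK -dvp1E; apply/negP => xy.
        have := dvpB xy (dvpD xe ye).
        have -> : x + y - 1 - (x - e + (y - e)) = 2 * e - 1 by comring.
        by rewrite D1.
      rewrite -(dvp_unit _ _ U); apply: dvp_congr.
      have -> : (x + y - 1) * (g * (y - x)) - g * (g + 1) * (y ^+ 2 - y)
        = (- g) * (x ^+ 2 - x + g * (y ^+ 2 - y)) by comring.
      exact: dvpMl (dvp_le kan kx).
    have -> : multiplicity x y g = multiplicity e e g.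
      by rewrite /multiplicity (nonunit_congr xe) (nonunit_congr ye).
    by rewrite -/P; case: P; rewrite ?mulr1 ?mulr0.
  under eq_bigr do rewrite -[_ * _]mul1r.
  by rewrite -mulr_suml cnt.
transitivity (\sum_(x <- reps (a + b) | dvp 1 (x - (1 - e)) &&
    dvp (a + b - n) (x ^+ 2 - x + g * (y ^+ 2 - y)))
    (multiplicity (1 - e) e g * (dvp (a - n) g)%:R)); last first.
  under eq_bigr do rewrite -[_ * _]mul1r.
  by rewrite -mulr_suml cnt.
rewrite big_mkcond [RHS]big_mkcond/=; apply: eq_bigr => x _.
rewrite /closed_code iy/=.
case: (boolP (dvp (a + b - n) _)) => kx; rewrite ?andbF//=.
have : dvp 1 ((x - e) * (x - (1 - e))).
  have -> : (x - e) * (x - (1 - e)) = x ^+ 2 - x + g * (y ^+ 2 - y)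
     - (g * (y ^+ 2 - y) + (e ^+ 2 - e)) by comring.
  by rewrite ee subrr addr0 dvpB// (dvp_le k0).
rewrite andbT dvp1M; case: (boolP (dvp 1 (x - (1 - e)))) =>
  [xe _|_]; last first.
  by rewrite orbF => ->; rewrite andbF.
have -> : dvp 1 (x - e) = false.
  apply/negP => /(dvpB xe).
  have -> : x - (1 - e) - (x - e) = 2 * e - 1 by comring.
  by rewrite D1.
have U : y - x \is a GRing.unit.
  rewrite -[_ \is a _]negbK -dvp1E; apply/negP => yx.
  have := dvpB yx (dvpB ye xe).
  have -> : y - x - (y - e - (x - (1 - e))) = 2 * e - 1 by comring.
  by rewrite D1.
rewrite andbT mulrC (dvp_unit _ _ U).
have -> : multiplicity x y g = multiplicity (1 - e) e g.
  by rewrite /multiplicity (nonunit_congr xe) (nonunit_congr ye).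
case: (boolP (dvp (a - n) g)) => [gn|_]; last by rewrite mulr0.
rewrite mulr1 (_ : dvp (a - (n + b)) _)//.
by apply: dvp_le (dvpMr _ gn); rewrite leq_sub2l// leq_addr.
Qed.

(** At most one factor is a nonunit, and that one carries the whole valuation. *)
Lemma dvp_mul_distinct m x y : x - y \is a GRing.unit ->
  dvp m (x * y) = dvp m x || dvp m y.
Proof.
case: m => [|m] U; first by rewrite !dvp0.
have [x1|] := boolP (dvp 1 x); last first.
  rewrite dvp1E negbK => xU; rewrite dvp_unit//.
  case: (boolP (dvp m.+1 x)) => //= /(@dvp_le 1 m.+1 _ isT).
  by rewrite dvp1E xU.
have yU : y \is a GRing.unit.
  by rewrite -(unitrN y) -(unit_of_dvp1 (x := x - y))// opprK subrK.
rewrite mulrC dvp_unit//; case: (boolP (dvp m.+1 y)) => [|_]; last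
  by rewrite orbF.
by move=> /(@dvp_le 1 m.+1 _ isT); rewrite dvp1E yU.
Qed.

Lemma sum_class m k c (w : K) : (m <= k)%N ->
  \sum_(x <- reps k) w * (dvp m (x - c))%:R = w * Q ^+ (k - m).
Proof.
move=> mk; rewrite -mulr_sumr -(@count_class m k c mk) [in RHS]big_mkcond/=.
by congr (_ * _); apply: eq_bigr => x _; case: ifP.
Qed.

Lemma sum_reps_nonunit k : \sum_(x <- reps k.+1) nonunit x = Q ^+ k.
Proof.
have := @sum_class 1 k.+1 0 1 isT; rewrite mul1r subn1 /= => <-.
by apply: eq_bigr => x _; rewrite subr0 mul1r.
Qed.

(** For positive [m] the solutions are the classes of 0 and -1; [1 + nonunit g] is 2 on the first
    and 1 on the second, whence the factor 3. *)
Lemma sum_consecutive m a : (m <= a.+1)%N ->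
  \sum_(g <- reps a.+1 | dvp m (g * (g + 1))) (1 + nonunit g) =
  if m == 0%N then Q ^+ a.+1 + Q ^+ a else 3 * Q ^+ (a.+1 - m).
Proof.
case: m => [|m] ma.
  under eq_bigl do rewrite dvp0.
  by rewrite big_split/= sum_reps_1 sum_reps_nonunit.
transitivity (\sum_(g <- reps a.+1)
   (2 * (dvp m.+1 (g - 0))%:R + 1 * (dvp m.+1 (g - (- 1)))%:R) : K); last first.
  by rewrite big_split/= !sum_class//; comring.
rewrite big_mkcond/=; apply: eq_bigr => g _; rewrite subr0 opprK /nonunit.
have gU : g + 1 - g \is a GRing.unit by rewrite addrAC subrr add0r unitr1.
rewrite [g * _]mulrC (dvp_mul_distinct _ gU) orbC.
case: (boolP (dvp m.+1 g)) => /= [gm|_].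
  have -> : dvp 1 g by exact: dvp_le gm.
  have -> : dvp m.+1 (g + 1) = false.
    apply/negP => /(@dvp_le 1 m.+1 _ isT); rewrite addrC dvpDr ?dvp1_1//.
    exact: dvp_le gm.
  by comring.
case: (boolP (dvp m.+1 (g + 1))) => [gm|_]; last by comring.
have -> : dvp 1 g = false; last by comring.
apply/negP => g1; move: (@dvp_le 1 m.+1 _ isT gm).
by rewrite addrC dvpDr// dvp1_1.
Qed.

(** The cofactor [y + e - 1] of [y - e] in [y^2 - y] is congruent to [2 e - 1], a unit. *)
Lemma dvp_sub_idempotent m y z e : e ^+ 2 = e -> dvp 1 (y - e) ->
  dvp m (z * (y ^+ 2 - y)) = dvp m (z * (y - e)).
Proof.
move=> ee ye.
have -> : z * (y ^+ 2 - y) = (y + e - 1) * (z * (y - e)) + z * (e ^+ 2 - e).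
  by comring.
rewrite ee subrr mulr0 addr0 dvp_unit// (@unit_of_dvp1 _ (2 * e - 1))
  ?idempotent_unit//.
by have -> : y + e - 1 - (2 * e - 1) = y - e by comring.
Qed.

Definition consecutive_sum n a b t : K :=
  \sum_(g <- reps a | dvp (a - n) (g * (g + 1) * t) &&
                      dvp (a - (n + b)) (g * (g + 1))) (1 + nonunit g).

(** A change of [t] by a multiple of [pi ^+ b] changes the first condition by a multiple of
    [g (g + 1) pi^b], which the second condition makes harmless. *)
Lemma consecutive_sum_periodic n a b : periodic b (consecutive_sum n a b).
Proof.
move=> t u /dvpP[c tu]; apply: eq_bigl => g.
case: (boolP (dvp (a - (n + b)) _)) => [gab|_]; last by rewrite !andbF.
rewrite !andbT; apply: dvp_congr; rewrite -mulrBr tu mulrA mulrC dvp_expM.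
by rewrite -subnDA dvpMr.
Qed.

Lemma consecutive_sum_unit n a b u t : u \is a GRing.unit ->
  consecutive_sum n a b (u * t) = consecutive_sum n a b t.
Proof. by move=> uU; apply: eq_bigl => g; rewrite mulrCA dvp_unit. Qed.

(** Since [j <= b], the condition weighted by [pi ^+ j] implies the other one, and [sum_consecutive]
    applies with modulus exponent [a.+1 - (n + j)]. *)
Lemma consecutive_sum_exp n a b j : (j <= b)%N ->
  consecutive_sum n a.+1 b (pi ^+ j) =
  if (a < n + j)%N then Q ^+ a.+1 + Q ^+ a else 3 * Q ^+ (n + j).
Proof.
move=> jb; transitivity (\sum_(g <- reps a.+1 | dvp (a.+1 - (n + j)) (g * (g +
  1)))
   (1 + nonunit g)); last first.
  rewrite sum_consecutive ?leq_subr//.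
  by rewrite subn_eq0; case: ltnP => // naj; rewrite subKn ?(leq_trans naj).
apply: eq_bigl => g; rewrite mulrC dvp_expM -subnDA.
apply: andb_idr; apply: dvp_le; rewrite leq_sub2l// leq_add2l//.
Qed.

(* Here [a] and [b] stand for [r1 - 1] and [r2 - 1]. The index [i] corresponds
   to [y - e] of valuation [b.+1 - i], where [e] is the root of [y^2 - y]
   congruent to [y] modulo [pi]. *)
Definition branch_sum n a b : K :=
  \sum_(i < b.+1 | (i <= n)%N) valuation_weight i *
    (if (a <= n + (b - i))%N then Q ^+ a.+1 + Q ^+ a
     else 3 * Q ^+ (n + (b - i)).+1).

Lemma sum_consecutive_sum n a b :
  \sum_(t <- reps b.+1 | dvp 1 t && dvp (b.+1 - n) t) consecutive_sum n a.+1
    b.+1 t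
  = branch_sum n a b.
Proof.
rewrite big_mkcond/= sum_reps_valuation; last 2 first.
- move=> t u tu; rewrite (consecutive_sum_periodic _ _ tu).
  by rewrite !(@dvp_congr _ t u)// (dvp_le _ tu)// leq_subr.
- by move=> u t uU; rewrite !dvp_unit// consecutive_sum_unit.
(* The top index is the class of units, excluded by the condition [dvp 1 t]; so the range of [i]
   shrinks to [b.+1]. *)
rewrite big_ord_recr/= subnn expr0 dvp1_1 mulr0 addr0 /branch_sum
  [RHS]big_mkcond/=.
apply: eq_bigr => -[i /= ib] _; rewrite !dvp_exp_pi subn_gt0 ib/=.
rewrite consecutive_sum_exp ?leq_subr// [(b.+1 - i)%N]subSn// addnS ltnS.
have -> : (b.+1 - n <= (b - i).+1)%N = (i <= n)%N by lia.
by case: ifP => // _; rewrite mulr0.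
Qed.

Lemma count_max1 n b :
  \sum_(t <- reps b.+1 | dvp 1 t && dvp (b.+1 - n) t) (1 : K) = Q ^+ minn n b.
Proof.
transitivity (\sum_(t <- reps b.+1 | dvp (maxn 1 (b.+1 - n)) (t - 0)) (1 : K)).
  apply: eq_bigl => t; rewrite subr0; case: (leqP 1 (b.+1 - n)) => h.
    by apply: andb_idl; exact: dvp_le.
  by move: h; rewrite ltnS leqn0 => /eqP ->; rewrite dvp0 andbT.
rewrite count_class; last by lia.
by congr (_ ^+ _); lia.
Qed.

Definition code_sum n a b y : K :=
  \sum_(g <- reps a) \sum_(x <- reps (a + b) | closed_code n a b x y g)
    multiplicity x y g.

(** After the translation [t = y - e], only the class where [x] is congruent to [e] still depends on
    [t]; the other contributes a constant times the number of allowed [t]. The factor [w] is 3 for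
    [e = 0] and 1 for [e = 1]. *)
Lemma sum_code_residue n a b e w : e ^+ 2 = e -> (n < a.+1 + b.+1)%N ->
  (forall g, multiplicity e e g = w * (1 + nonunit g)) ->
  \sum_(y <- reps b.+1 | dvp 1 (y - e)) code_sum n a.+1 b.+1 y =
  Q ^+ n * (w * branch_sum n a b + Q ^+ minn n b *
    \sum_(g <- reps a.+1 | dvp (a.+1 - n) g) multiplicity (1 - e) e g).
Proof.
move=> ee nab we; set C := \sum_(g <- reps a.+1 | _) _.
pose F t := if dvp 1 t && dvp (b.+1 - n) t
  then Q ^+ n * (w * consecutive_sum n a.+1 b.+1 t + C) else 0.
transitivity (\sum_(y <- reps b.+1) F (y - e)).
  rewrite big_mkcond/=; apply: eq_bigr => y _; rewrite /F.
  case: (boolP (dvp 1 (y - e))) => //= ye.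
  rewrite -[y - e in X in if X then _ else _]mul1r.
  rewrite -dvp_sub_idempotent// mul1r; case: (boolP (dvp _ (y ^+ 2 - y))) => iy.
    rewrite /code_sum; under eq_bigr do rewrite (sum_code_nonunit _ ee ye nab
      iy).
    rewrite -mulr_sumr big_split/=; congr (_ * (_ + _)).
      rewrite /consecutive_sum mulr_sumr [RHS]big_mkcond/=.
      apply: eq_bigr => g _.
      by rewrite (dvp_sub_idempotent _ _ ee ye) we; case: ifP;
        rewrite ?mulr1 ?mulr0.
    by rewrite /C [RHS]big_mkcond/=; apply: eq_bigr => g _;
      case: ifP; rewrite ?mulr1 ?mulr0.
  by apply: big1 => g _; apply: big1 => x; rewrite /closed_code (negbTE iy).
rewrite sum_reps_bij; last 2 first.
- move=> t u tu; rewrite /F (consecutive_sum_periodic _ _ tu).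
  by rewrite !(@dvp_congr _ t u)// (dvp_le _ tu)// leq_subr.
- by move=> x y; rewrite opprB addrA subrK.
rewrite /F -big_mkcond/= -mulr_sumr big_split/= -mulr_sumr sum_consecutive_sum.
congr (_ * (_ + _)); rewrite -count_max1 mulr_suml.
by apply: eq_bigr => t _; rewrite mul1r.
Qed.

(** * Codes with y^2 - y a unit *)

Lemma dvp_nonunit m x : ~~ dvp 1 x -> dvp m.+1 x = false.
Proof. by move=> x1; apply: contraNF x1; exact: dvp_le. Qed.

(** With [u = y^2 - y] and the solution [g = - (x^2 - x) / u], one has [u^2 g (g + 1) = (x^2 - x) (x
    - y) (x + y - 1)]; hence the third congruence implies the fourth. *)
Lemma closed_code_unit n a b x y g : y ^+ 2 - y \is a GRing.unit ->
  (b <= n)%N ->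
  closed_code n a b x y g =
  dvp (a + b - n) (g - - ((x ^+ 2 - x) / (y ^+ 2 - y)))
  && dvp (a - n) ((x ^+ 2 - x) * (x - y)).
Proof.
set u := _ - y => uU bn.
have bn0 : (b - n = 0)%N by lia.
rewrite /closed_code bn0 dvp0/= -/u opprK.
have -> : x ^+ 2 - x + g * u = u * (g + (x ^+ 2 - x) / u).
  have -> : u * (g + (x ^+ 2 - x) / u) = (x ^+ 2 - x) * (u / u) + g * u
    by comring.
  by rewrite divrr// mulr1.
rewrite dvp_unit//; apply: andb_id2l; set g0 := (x ^+ 2 - x) / u => gg0.
have xg0 : x ^+ 2 - x = u * g0 by rewrite mulrC divrK.
have gk : dvp (a - n) (g + g0) by apply: dvp_le gg0; lia.
have -> : dvp (a - n) (g * (y - x)) = dvp (a - n) ((x ^+ 2 - x) * (x - y)).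
  rewrite xg0 -mulrA (dvp_unit _ _ uU); apply: dvp_congr.
  have -> : g * (y - x) - g0 * (x - y) = (g + g0) * (y - x) by comring.
  exact: dvpMr.
apply: andb_idr => h.
have -> : g * (g + 1) = (g + g0) * (g - g0 + 1) + g0 * (g0 - 1) by comring.
apply: (@dvp_le _ (a - n)); first by rewrite leq_sub2l// leq_addr.
apply: dvpD; first exact: dvpMr.
rewrite -(dvp_unit _ _ uU) -(dvp_unit _ _ uU).
have -> : u * (u * (g0 * (g0 - 1))) = (u * g0) * (u * g0 - u) by comring.
rewrite -xg0; have -> : (x ^+ 2 - x) * (x ^+ 2 - x - u)
   = (x ^+ 2 - x) * (x - y) * (x + y - 1) by rewrite /u; comring.
exact: dvpMr.
Qed.

(* The main congruence is linear in [g], hence determines [g] modulo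
   [pi^(r1+r2-n)], where [r1 = a + 1] and [r2 = b + 1]; the other ones then say
   that [x] is congruent to [0], [1] or [y] modulo [pi^(r1-n)]. *)
Lemma sum_code_unit n a b y : y ^+ 2 - y \is a GRing.unit -> (b < n)%N ->
  (n < a.+1 + b.+1)%N ->
  code_sum n a.+1 b.+1 y =
  if (a < n)%N then (Q + 3) * Q ^+ (a + n) else 6 * Q ^+ (n + n).
Proof.
move=> uU bn nab; set u := y ^+ 2 - y in uU *.
have [yU y1U] : y \is a GRing.unit /\ y - 1 \is a GRing.unit.
  apply/andP; rewrite -unitrM.
  by have -> : y * (y - 1) = u by rewrite /u; comring.
(* As [y] is a unit, the multiplicity is [1 + nonunit g (1 + nonunit x)], and the solution [g] is a
   nonunit exactly when [x^2 - x] is. *)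
pose f x : K := (dvp (a.+1 - n) ((x ^+ 2 - x) * (x - y)))%:R
  * (1 + nonunit (x ^+ 2 - x) * (1 + nonunit x)).
have -> : code_sum n a.+1 b.+1 y
    = Q ^+ (n - b.+1) * \sum_(x <- reps (a.+1 + b.+1)) f x.
  rewrite /code_sum; under eq_bigr do rewrite big_mkcond/=.
  rewrite exchange_big/= mulr_sumr; apply: eq_bigr => x _.
  set g0 := - ((x ^+ 2 - x) / u).
  transitivity (\sum_(g <- reps a.+1) f x * (dvp (a.+1 + b.+1 - n)
    (g - g0))%:R).
    apply: eq_bigr => g _; rewrite closed_code_unit// -/u -/g0.
    case: (boolP (dvp _ (g - g0))) => /= [gg0|_]; last by rewrite mulr0.
    rewrite /f mulr1; case: ifP => _ /=; last by rewrite mul0r.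
    have g1 : dvp 1 (g - g0) by apply: dvp_le gg0; lia.
    have -> : nonunit (x ^+ 2 - x) = nonunit g.
      have uVU : u^-1 \is a GRing.unit by rewrite unitrV.
      by rewrite (nonunit_congr g1) /nonunit /g0 dvpN [_ / u]mulrC
        (dvp_unit _ _ uVU).
    have y0 : nonunit y = 0 by rewrite /nonunit dvp1E yU.
    by rewrite /multiplicity y0; comring.
  rewrite sum_class; last by lia.
  by rewrite mulrC; congr (Q ^+ _ * _); lia.
case: ltnP => an.
  have an0 : (a.+1 - n = 0)%N by lia.
  transitivity (Q ^+ (n - b.+1) * (\sum_(x <- reps (a.+1 + b.+1))
     (1 + 2 * (dvp 1 (x - 0))%:R + 1 * (dvp 1 (x - 1))%:R))).
    congr (_ * _); apply: eq_bigr => x _; rewrite /f an0 dvp0 mul1r subr0.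
    rewrite /nonunit; have -> : x ^+ 2 - x = x * (x - 1) by comring.
    rewrite dvp1M; case: (boolP (dvp 1 x)) => x1/=.
      have -> : dvp 1 (x - 1) = false by rewrite addrC dvpDr// dvpN dvp1_1.
      by comring.
    by comring.
  rewrite !big_split/= sum_reps_1 !sum_class//.
  have -> : (a.+1 + b.+1 - 1 = a + b.+1)%N by lia.
  have -> : (a + n = (n - b.+1) + (a + b.+1))%N by lia.
  by rewrite [in RHS]exprD addSn exprS; comring.
(* The residues 0, 1 and that of [y] are distinct, so only one factor of [x (x - 1) (x - y)] can be
   a nonunit. The multiplicities on the three classes are 3, 2 and 1, whence the total 6. *)
transitivity (Q ^+ (n - b.+1) * (\sum_(x <- reps (a.+1 + b.+1))
   (3 * (dvp (a.+1 - n) (x - 0))%:R + 2 * (dvp (a.+1 - n) (x - 1))%:R +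
    1 * (dvp (a.+1 - n) (x - y))%:R))).
  congr (_ * _); apply: eq_bigr => x _; rewrite /f subr0 subSn//.
  set m := (a - n)%N; rewrite /nonunit.
  have -> : x ^+ 2 - x = x * (x - 1) by comring.
  rewrite dvp1M.
  have yN : ~~ dvp 1 y by rewrite dvp1E yU.
  have y1N : ~~ dvp 1 (y - 1) by rewrite dvp1E y1U.
  case: (boolP (dvp 1 x)) => x1/=.
    have x1U : ~~ dvp 1 (x - 1) by rewrite addrC dvpDr// dvpN dvp1_1.
    have xyU : ~~ dvp 1 (x - y) by rewrite addrC dvpDr// dvpN.
    rewrite (dvp_nonunit m x1U) (dvp_nonunit m xyU) !mulr0 !addr0.
    have -> : x * (x - 1) * (x - y) = (x - 1) * (x - y) * x by comring.
    rewrite dvp_unit; first by comring.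
    by move: x1U xyU; rewrite !dvp1E !negbK unitrM => -> ->.
  rewrite (dvp_nonunit m x1); have xU : x \is a GRing.unit by move: x1;
    rewrite dvp1E negbK.
  case: (boolP (dvp 1 (x - 1))) => x11/=.
    have xyU : ~~ dvp 1 (x - y).
      have -> : x - y = - (y - 1) + (x - 1) by comring.
      by rewrite dvpDr// dvpN.
    rewrite (dvp_nonunit m xyU).
    have -> : x * (x - 1) * (x - y) = x * (x - y) * (x - 1) by comring.
    rewrite dvp_unit; first by comring.
    by move: xyU; rewrite dvp1E negbK unitrM xU => ->.
  rewrite (dvp_nonunit m x11) dvp_unit; first by case: (dvp m.+1 (x - y));
    comring.
  by move: x11; rewrite dvp1E negbK unitrM xU => ->.
rewrite !big_split/= !sum_class//; try lia.
have -> : (n + n = (n - b.+1) + (a.+1 + b.+1 - (a.+1 - n)))%N by lia.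
by rewrite [in RHS]exprD; comring.
Qed.

(** * The total number of codes *)

Definition total_sum n a b : K := \sum_(y <- reps b) code_sum n a b y.

(** All congruences are void. The factor [(Q + 1) (Q^2 + Q + 1)] is the number of complete flags in
    a three-dimensional space over the residue field. *)
Lemma total_sum_free n a b : (a.+1 + b.+1 <= n)%N ->
  total_sum n a.+1 b.+1 = (Q + 1) * (Q ^+ 2 + Q + 1) * Q ^+ (a + b + a + b).+1.
Proof.
move=> nab.
have affine k (c d : K) :
    \sum_(x <- reps k.+1) (c + d * nonunit x) = Q ^+ k * (c * Q + d).
  rewrite big_split/= -mulr_sumr sum_reps_nonunit.
  have -> : \sum_(x <- reps k.+1) c = c * Q ^+ k.+1.
    by rewrite -sum_reps_1 mulr_sumr; apply: eq_bigr => x _; rewrite mulr1.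
  by rewrite exprS; comring.
have closed x y g : closed_code n a.+1 b.+1 x y g.
  rewrite /closed_code.
  have [-> -> -> ->] : [/\ b.+1 - n = 0, a.+1 + b.+1 - n = 0, a.+1 - n = 0 &
     a.+1 - (n + b.+1) = 0]%N by split; lia.
  by rewrite !dvp0.
transitivity (\sum_(y <- reps b.+1) \sum_(g <- reps a.+1)
  Q ^+ (a + b.+1) * ((Q + (Q + 1) * nonunit y)
     + (Q + 1 + nonunit y) * nonunit g)).
  apply: eq_bigr => y _; apply: eq_bigr => g _.
  under eq_bigl do rewrite closed.
  rewrite addSn -[RHS](_ : Q ^+ (a + b.+1) * ((1 + nonunit g + nonunit y) * Q +
    (nonunit g + nonunit y + nonunit y * nonunit g)) = _); last by comring.
  by rewrite -affine; apply: eq_bigr => x _; rewrite /multiplicity; comring.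
transitivity (\sum_(y <- reps b.+1) Q ^+ (a + b.+1) * Q ^+ a *
   ((Q ^+ 2 + Q + 1) + (Q ^+ 2 + Q + 1) * nonunit y)).
  by apply: eq_bigr => y _; rewrite -mulr_sumr affine; comring.
rewrite -mulr_sumr affine.
have -> : ((a + b + a + b).+1 = a + b.+1 + a + b)%N by lia.
by rewrite !exprD; comring.
Qed.

Lemma sum_class_divisible n a : \sum_(g <- reps a.+1 | dvp (a.+1 - n) g)
    (1 + nonunit g) = if (a < n)%N then Q ^+ a.+1 + Q ^+ a else 2 * Q ^+ n.
Proof.
case: ltnP => an.
  have -> : (a.+1 - n = 0)%N by lia.
  under eq_bigl do rewrite dvp0.
  by rewrite big_split/= sum_reps_1 sum_reps_nonunit.
rewrite -[in RHS](subKn (leqW an)) -(@sum_class _ _ 0) ?leq_subr//.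
rewrite big_mkcond/=; apply: eq_bigr => g _; rewrite subr0.
case: (boolP (dvp (a.+1 - n) g)) => [ga|_]; last by rewrite mulr0.
have g1 : dvp 1 g by apply: dvp_le ga; rewrite subn_gt0.
by rewrite /nonunit g1; comring.
Qed.

(** The residues 0 and 1 of [y] give branch sums of weights 3 and 1, whence the 4. The classes where
    [x] and [y] have opposite residues have multiplicities [2 + nonunit g] and [1 + 2 nonunit g],
    whence the 3. For the other [q - 2] residues [y^2 - y] is a unit, and the first congruence holds
    only if it is void, that is for [b < n]. *)
Lemma total_sum_bound n a b : (n < a.+1 + b.+1)%N ->
  total_sum n a.+1 b.+1 =
  (if (b < n)%N then (Q - 2) * Q ^+ b *
     (if (a < n)%N then (Q + 3) * Q ^+ (a + n) else 6 * Q ^+ (n + n)) else 0)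
  + Q ^+ n * (4 * branch_sum n a b + 3 * Q ^+ minn n b *
      (if (a < n)%N then Q ^+ a.+1 + Q ^+ a else 2 * Q ^+ n)).
Proof.
move=> nab.
have n0 : nonunit 0 = 1 by rewrite /nonunit dvp_0.
have n1 : nonunit 1 = 0 by rewrite /nonunit dvp1_1.
have e0 : (0 : o) ^+ 2 = 0 by rewrite expr0n.
have e1 : (1 : o) ^+ 2 = 1 by rewrite expr1n.
have S0 := @sum_code_residue n a b 0 3 e0 nab.
have S1 := @sum_code_residue n a b 1 1 e1 nab.
rewrite /total_sum (bigID (fun y => dvp 1 (y - 0)))/=.
rewrite [X in _ + X](bigID (fun y => dvp 1 (y - 1)))/=.
rewrite [X in _ + (X + _)](_ : _ = \sum_(y <- reps b.+1 | dvp 1 (y - 1))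
  code_sum n a.+1 b.+1 y); last first.
  apply: eq_bigl => y; apply: andb_idl => y1.
  by rewrite subr0 (dvp_congr y1) dvp1_1.
rewrite S0 ?S1; last 2 first.
- by move=> g; rewrite /multiplicity n1; comring.
- by move=> g; rewrite /multiplicity n0; comring.
rewrite subr0 subrr -sum_class_divisible [X in _ + (_ + X)](_ : _ =
  if (b < n)%N then (Q - 2) * Q ^+ b *
     (if (a < n)%N then (Q + 3) * Q ^+ (a + n) else 6 * Q ^+ (n + n)) else 0).
  set D := fun g => dvp (a.+1 - n) g.
  have E : \sum_(g <- reps a.+1 | D g) multiplicity 1 0 g +
           \sum_(g <- reps a.+1 | D g) multiplicity 0 1 g =
           3 * \sum_(g <- reps a.+1 | D g) (1 + nonunit g).
    rewrite -big_split mulr_sumr; apply: eq_bigr => g _.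
    by rewrite /multiplicity n0 n1/=; comring.
  set B := branch_sum n a b; set S10 := \sum_(g <- _ | _) multiplicity 1 0 g in
    E *.
  set S01 := \sum_(g <- _ | _) multiplicity 0 1 g in E *.
  have -> : 3 * Q ^+ minn n b * (\sum_(g <- reps a.+1 | D g) (1 + nonunit g))
      = Q ^+ minn n b * (S10 + S01) by rewrite E; comring.
  set c := if (b < n)%N then _ else _.
  by comring.
have uP y : ~~ dvp 1 (y - 0) && ~~ dvp 1 (y - 1) =
  (y ^+ 2 - y \is a GRing.unit).
  have -> : y ^+ 2 - y = (y - 0) * (y - 1) by comring.
  by rewrite !dvp1E !negbK unitrM.
under eq_bigl do rewrite uP.
case: ltnP => bn.
  set c := if (a < n)%N then _ else _.
  under eq_bigr => y yU do rewrite sum_code_unit// -/c -[c]mul1r.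
  rewrite -mulr_suml; congr (_ * _).
  transitivity (\sum_(y <- reps b.+1)
    (1 + (- 1) * (dvp 1 (y - 0))%:R + (- 1) * (dvp 1 (y - 1))%:R) : K).
    rewrite big_mkcond/=; apply: eq_bigr => y _; rewrite -uP.
    case: (boolP (dvp 1 (y - 0))) => y0 /=.
      rewrite (_ : dvp 1 (y - 1) = false); first by comring.
      by rewrite addrC dvpDr ?dvpN ?dvp1_1// -[y]subr0.
    by case: (dvp 1 (y - 1)) => /=; comring.
  rewrite !big_split/= sum_reps_1 !sum_class// subn1/= exprS; comring.
apply: big1 => y yU; apply: big1 => g _; apply: big1 => x.
rewrite /closed_code subSn// dvp_nonunit ?dvp1E ?negbK//.
Qed.

(** * Lattices in normal form *)

Lemma dvpM j k x y : dvp j x -> dvp k y -> dvp (j + k) (x * y).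
Proof.
move=> /dvpP[s ->] /dvpP[t ->]; apply/dvpP; exists (s * t).
by rewrite exprD; comring.
Qed.

Definition axis_order := ('I_3 * 'I_3 * 'I_3)%type.

Definition distinct_axes (c : axis_order) : bool :=
  let: (c1, c2, c3) := c in [&& c1 != c2, c1 != c3 & c2 != c3].

Lemma axisP (c1 c2 c3 k : 'I_3) : distinct_axes (c1, c2, c3) ->
  [\/ k = c1, k = c2 | k = c3].
Proof.
case: c1 c2 c3 k => [[|[|[]]]//= i1] [[|[|[]]]//= i2] [[|[|[]]]//= i3]
  [[|[|[]]]//= i4] //= _;
  by [apply: Or31; apply: val_inj|apply: Or32; apply: val_inj|apply: Or33;
    apply: val_inj].
Qed.

(** [form3], [form2] and [form1] are the coordinates of [z] in the basis [v], [w], [e_c2] of [o3].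
    Defining the lattice by them makes membership three divisibilities and its quotient map
    explicit. *)
Definition form2 (c : axis_order) (y : o) (z : o3 o) : o :=
  let: (c1, c2, c3) := c in z c3 - z c1 * y.

Definition form1 (c : axis_order) (x y g : o) (z : o3 o) : o :=
  let: (c1, c2, c3) := c in z c2 - z c1 * x + g * form2 c y z.

Definition form3 (c : axis_order) (z : o3 o) : o := z c.1.1.

(* The lattice spanned by [pi^n (e_c1 + x e_c2 + y e_c3)], [pi^(n+b) (e_c3 - g
   e_c2)] and [pi^(n+a+b) e_c2]; see [mem_latticeP]. *)
Definition lattice_pred n a b c x y g : {pred o3 o} := fun z =>
  [&& dvp (n + a + b) (form1 c x y g z), dvp (n + b) (form2 c y z)
    & dvp n (form3 c z)].

Fact lattice_closed n a b c x y g : submod_closed (lattice_pred n a b c x y g).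
Proof.
case: c => [[c1 c2] c3]; split=> [|r u v]; rewrite /in_mem/= /lattice_pred/=.
  by rewrite /form1 /form2 /form3 !ffunE !mul0r !subr0 mulr0 addr0 !dvp_0.
move=> /and3P[u1 u2 u3] /and3P[v1 v2 v3].
rewrite /form1 /form2 /form3/= in u1 u2 u3 v1 v2 v3 *.
have E k : (r *: u + v) k = r * u k + v k by rewrite !ffunE.
rewrite !E; apply/and3P; split; last exact: (dvpD (dvpMl r u3) v3).
  have -> : r * u c2 + v c2 - (r * u c1 + v c1) * x +
     g * (r * u c3 + v c3 - (r * u c1 + v c1) * y) =
     r * (u c2 - u c1 * x + g * (u c3 - u c1 * y)) +
     (v c2 - v c1 * x + g * (v c3 - v c1 * y)) by comring.
  exact: (dvpD (dvpMl r u1) v1).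
have -> : r * u c3 + v c3 - (r * u c1 + v c1) * y =
  r * (u c3 - u c1 * y) + (v c3 - v c1 * y) by comring.
exact: (dvpD (dvpMl r u2) v2).
Qed.

Definition lattice n a b c x y g : submodule (o3 o) :=
  Submodule (lattice_closed n a b c x y g).

Definition vec (c : axis_order) (z1 z2 z3 : o) : o3 o :=
  [ffun k => if k == c.1.1 then z1 else if k == c.1.2 then z2 else z3].

Lemma vecE c1 c2 c3 z1 z2 z3 : distinct_axes (c1, c2, c3) ->
  [/\ vec (c1, c2, c3) z1 z2 z3 c1 = z1, vec (c1, c2, c3) z1 z2 z3 c2 = z2
    & vec (c1, c2, c3) z1 z2 z3 c3 = z3].
Proof.
move=> /and3P[c12 c13 c23]; rewrite /vec !ffunE/= eqxx ![_ == c1]eq_sym.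
by rewrite (negbTE c12) (negbTE c13) eqxx eq_sym (negbTE c23).
Qed.

Lemma mem_lattice n a b c x y g z : (z \in lattice n a b c x y g) =
  [&& dvp (n + a + b) (form1 c x y g z), dvp (n + b) (form2 c y z)
    & dvp n (form3 c z)].
Proof. by []. Qed.

Lemma mem_latticeP n a b c1 c2 c3 x y g (z : o3 o) :
  reflect (exists t s r, [/\ z c1 = pi ^+ n * t, z c3 = pi ^+ n * (t * y +
    pi ^+ b * s) &
     z c2 = pi ^+ n * (t * x - g * pi ^+ b * s + pi ^+ (a + b) * r)])
  (z \in lattice n a b (c1, c2, c3) x y g).
Proof.
rewrite mem_lattice /form1 /form2 /form3/=; apply: (iffP and3P).
  move=> [/dvpP[r z1] /dvpP[s z2] /dvpP[t z3]]; exists t, s, r.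
  rewrite z2 in z1; rewrite !z3 in z1 z2 *; split; first by rewrite mulrC.
    by move/(canRL (subrK _)): z2 => ->; rewrite exprD; comring.
  move/(canRL (addrK _)): z1 => /(canRL (subrK _)) ->; rewrite !exprD; comring.
move=> [t [s [r [z1 z3 z2]]]].
have e2 : z c3 - z c1 * y = s * pi ^+ (n + b) by rewrite z1 z3 exprD; comring.
split; last by rewrite z1 dvpMr// dvp_exp.
  by apply/dvpP; exists r; rewrite e2 z1 z2 !exprD; comring.
by apply/dvpP; exists s.
Qed.

(** The third generator times any vector of the lattice is a multiple of itself, and the coordinates
    of [v w] and [w^2] along [v] and [w] are divisible enough anyway. Scaling by [pi ^+ n]
    multiplies products by [pi ^+ (n + n)], which relaxes each congruence by [n]. *)
Lemma lattice_mul_closed n a b c1 c2 c3 x y g : distinct_axes (c1, c2, c3) ->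
  (forall u v : o3 o, u \in lattice n a b (c1, c2, c3) x y g ->
     v \in lattice n a b (c1, c2, c3) x y g ->
     u * v \in lattice n a b (c1, c2, c3) x y g) <->
  closed_code n a b x y g.
Proof.
move=> cd; set L := lattice _ _ _ _ _ _ _.
have M (u v : o3 o) k : (u * v) k = u k * v k by rewrite !ffunE.
have e1 (w : o) : dvp (n + a + b) (pi ^+ n * (pi ^+ n * w)) = dvp (a + b - n) w.
  by rewrite -addnA dvp_cancel dvp_expM.
split=> [Lmul|].
  pose v := vec (c1, c2, c3) (pi ^+ n) (pi ^+ n * x) (pi ^+ n * y).
  pose w := vec (c1, c2, c3) 0 (pi ^+ n * (- g * pi ^+ b)) (pi ^+ n * pi ^+ b).
  have [v1 v2 v3] := vecE (pi ^+ n) (pi ^+ n * x) (pi ^+ n * y) cd.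
  have [w1 w2 w3] := vecE 0 (pi ^+ n * (- g * pi ^+ b)) (pi ^+ n * pi ^+ b) cd.
  rewrite -/v in v1 v2 v3; rewrite -/w in w1 w2 w3.
  have vL : v \in L.
    apply/mem_latticeP; exists 1, 0, 0; rewrite v1 v2 v3; split; comring.
  have wL : w \in L.
    apply/mem_latticeP; exists 0, 1, 0; rewrite w1 w2 w3; split; comring.
  have := Lmul _ _ vL vL; have := Lmul _ _ vL wL; have := Lmul _ _ wL wL.
  rewrite !mem_lattice /form1 /form2 /form3/= !M v1 v2 v3 w1 w2 w3.
  move=> /and3P[ww _ _] /and3P[vw _ _] /and3P[vv1 vv2 _]; rewrite /closed_code.
  apply/and4P; split.
  - move: vv2; have -> : pi ^+ n * y * (pi ^+ n * y) - pi ^+ n * pi ^+ n * y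
      = pi ^+ n * (pi ^+ n * (y ^+ 2 - y)) by comring.
    by rewrite dvp_cancel dvp_expM.
  - move: vv1; set lhs := (X in dvp _ X -> _).
    have -> : lhs = pi ^+ n * (pi ^+ n * (x ^+ 2 - x + g * (y ^+ 2 - y))).
      by rewrite /lhs; comring.
    by rewrite e1.
  - move: vw; set lhs := (X in dvp _ X -> _).
    have -> : lhs = pi ^+ n * (pi ^+ n * (pi ^+ b * (g * (y - x)))).
      by rewrite /lhs; comring.
    rewrite e1 dvp_expM; congr dvp; lia.
  move: ww; set lhs := (X in dvp _ X -> _).
  have -> : lhs = pi ^+ n * (pi ^+ n * (pi ^+ b * (pi ^+ b * (g * (g + 1))))).
    by rewrite /lhs; comring.
  rewrite e1 !dvp_expM; congr dvp; lia.
move=> /and4P[c_i c_ii c_iii c_iv] u v.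
move=> /mem_latticeP[t [s [r [u1 u3 u2]]]] /mem_latticeP[t'
  [s' [r' [v1 v3 v2]]]].
rewrite mem_lattice /form1 /form2 /form3/= !M u1 u2 u3 v1 v2 v3.
set P := pi ^+ n; set B := pi ^+ b.
apply/and3P; split; last by rewrite -mulrA dvpMr// dvp_exp.
  set lhs := (X in dvp _ X).
  have -> : lhs = P * (P * (t * t' * (x ^+ 2 - x + g * (y ^+ 2 - y))
      + (t * s' + t' * s) * (B * (g * (y - x)))
      + s * s' * (B * (B * (g * (g + 1))))
      + pi ^+ (a + b) * (r * (t' * x - g * B * s') + r' * (t * x - g * B * s)
           + r * r' * pi ^+ (a + b)))).
    by rewrite /lhs; comring.
  rewrite e1; apply: dvpD; last by rewrite dvpMr// dvp_exp// leq_subr.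
  apply: dvpD; last first.
    apply: dvpMl; rewrite !dvp_expM; move: c_iv; congr dvp; lia.
  apply: dvpD; first exact: dvpMl.
  apply: dvpMl; rewrite dvp_expM; move: c_iii; congr dvp; lia.
set lhs := (X in dvp _ X).
have -> : lhs = P * (P * (t * t' * (y ^+ 2 - y))
      + B * (P * (t * y * s' + t' * y * s + B * s * s'))).
  by rewrite /lhs; comring.
rewrite dvp_cancel; apply: dvpD; last by rewrite dvpMr// dvp_exp.
by rewrite dvp_expM dvpMl.
Qed.

(* The pivot [c1] of [v] is its first unit coordinate, and the pivot [c3] of
   [w] is the first unit coordinate of [w]. *)
Definition admissible (c : axis_order) (x y g : o) : bool :=
  let: (c1, c2, c3) := c in
  [&& (c2 < c1)%N ==> dvp 1 x, (c3 < c1)%N ==> dvp 1 y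
    & (c2 < c3)%N ==> dvp 1 g].

(** The difference of the two vectors [v] is [(y - y') w] plus [x - x' + g (y - y')] times [e_c2];
    so [x] is compared only after this correction. *)
Lemma lattice_congr n a b c x y g x' y' g' :
  dvp b (y - y') -> dvp a (g - g') -> dvp (a + b) (x - x' + g * (y - y')) ->
  lattice n a b c x y g = lattice n a b c x' y' g'.
Proof.
case: c => [[c1 c2] c3] yy gg xx; apply: submodule_eq => z.
rewrite !mem_lattice /form1 /form2 /form3/= [LHS]andbA [RHS]andbA.
case: (boolP (dvp n (z c1))) => [z1|]; last by rewrite !andbF.
rewrite !andbT ![_ && dvp (n + b) _]andbC.
have e2 : dvp (n + b) (z c3 - z c1 * y) = dvp (n + b) (z c3 - z c1 * y').
  apply: dvp_congr.
  have -> : z c3 - z c1 * y - (z c3 - z c1 * y') = - (z c1 * (y - y'))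
    by comring.
  by rewrite dvpN dvpM.
rewrite e2; apply: andb_id2l => z2; apply: dvp_congr.
have -> : z c2 - z c1 * x + g * (z c3 - z c1 * y) -
   (z c2 - z c1 * x' + g' * (z c3 - z c1 * y')) =
   (z c3 - z c1 * y') * (g - g') - z c1 * (x - x' + g * (y - y')) by comring.
apply: dvpB; first by rewrite addnAC; exact: dvpM.
by rewrite -addnA; exact: dvpM.
Qed.

(** Modulo [pi ^+ n.+1] the larger lattice is spanned by [pi ^+ n] times its vector [v], whose
    coordinates before [c1'] lie in the maximal ideal; so it has no element with coordinate
    [pi ^+ n] at an earlier axis. *)
Lemma lattice_sub_pivot n a b c1 c2 c3 x y g c1' c2' c3' x' y' g' :
  distinct_axes (c1, c2, c3) -> distinct_axes (c1', c2', c3') ->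
  admissible (c1', c2', c3') x' y' g' ->
  (forall z, z \in lattice n a.+1 b.+1 (c1, c2, c3) x y g ->
     z \in lattice n a.+1 b.+1 (c1', c2', c3') x' y' g') ->
  (c1' <= c1)%N.
Proof.
move=> cd cd' /and3P[x1 y1 _] LL; rewrite leqNgt; apply/negP => cc.
pose v := vec (c1, c2, c3) (pi ^+ n) (pi ^+ n * x) (pi ^+ n * y).
have [v1 v2 v3] := vecE (pi ^+ n) (pi ^+ n * x) (pi ^+ n * y) cd.
have /LL : v \in lattice n a.+1 b.+1 (c1, c2, c3) x y g.
  apply/mem_latticeP; exists 1, 0, 0; rewrite v1 v2 v3; split; comring.
move=> /mem_latticeP[t [s [r [z1 z3 z2]]]].
have pin : pi ^+ n != 0 by rewrite expf_neq0// pi_neq0.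
have [k1|k2|k3] := axisP c1 cd'; first by rewrite k1 ltnn in cc.
  move: z2; rewrite -k2 v1 -{1}[pi ^+ n]mulr1 => /(mulfI pin) e.
  have := dvp1_1; rewrite e -[pi ^+ b.+1]mulr1 exprS addSn exprS => /negP;
    apply.
  rewrite -k2 cc/= in x1; apply: dvpD; first apply: dvpB.
  - exact: dvpMl.
  - by rewrite !mulrA -!mulrA mulrCA -[pi in dvp _ (pi * _)]expr1 !dvpMr
    ?dvp_exp.
  - by rewrite -mulrA -[pi in dvp _ (pi * _)]expr1 !dvpMr ?dvp_exp.
move: z3; rewrite -k3 v1 -{1}[pi ^+ n]mulr1 => /(mulfI pin) e.
have := dvp1_1; rewrite e => /negP; apply; rewrite -k3 cc/= in y1.
apply: dvpD; first exact: dvpMl.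
by rewrite dvpMr ?dvp_exp.
Qed.

Lemma lattice_inj n a b c x y g c' x' y' g' :
  distinct_axes c -> distinct_axes c' ->
  admissible c x y g -> admissible c' x' y' g' ->
  x \in reps (a.+1 + b.+1) -> x' \in reps (a.+1 + b.+1) ->
  y \in reps b.+1 -> y' \in reps b.+1 -> g \in reps a.+1 -> g' \in reps a.+1 ->
  lattice n a.+1 b.+1 c x y g = lattice n a.+1 b.+1 c' x' y' g' ->
  (c, x, y, g) = (c', x', y', g').
Proof.
case: c c' => [[c1 c2] c3] [[c1' c2'] c3'] cd cd' adm adm' xr xr' yr yr' gr gr'
  LL.
have pin : pi ^+ n != 0 by rewrite expf_neq0// pi_neq0.
have e1 : c1 = c1'.
  apply/val_inj/anti_leq/andP; split.
    by apply: (@lattice_sub_pivot n a b _ _ _ x' y' g' _ _ _ x y g cd' cd adm)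
      => z; rewrite LL.
  by apply: (@lattice_sub_pivot n a b _ _ _ x y g _ _ _ x' y' g' cd cd' adm')
    => z; rewrite LL.
subst c1'.
(* If both orders of the last two axes occurred, testing [w] of the first lattice in the second
   would make [1 - G' G] a nonunit, although [G] is a nonunit. *)
have swap d2 d3 X Y G X' Y' G' : distinct_axes (c1, d2, d3) ->
    admissible (c1, d2, d3) X Y G -> (d2 < d3)%N ->
    lattice n a.+1 b.+1 (c1, d2, d3) X Y G = lattice n a.+1 b.+1 (c1, d3,
      d2) X' Y' G' -> False.
  move=> dd /and3P[_ _ G1] d23; rewrite d23/= in G1.
  pose w := vec (c1, d2, d3) 0 (pi ^+ n * (- G * pi ^+ b.+1)) (pi ^+ n * pi ^+
    b.+1).
  have [w1 w2 w3] := vecE 0 (pi ^+ n * (- G * pi ^+ b.+1)) (pi ^+ n * pi ^+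
    b.+1) dd.
  have wL : w \in lattice n a.+1 b.+1 (c1, d2, d3) X Y G.
    apply/mem_latticeP; exists 0, 1, 0; rewrite w1 w2 w3; split; comring.
  move=> LL'; move: wL; rewrite LL' mem_lattice /form1 /form2 /form3/= w1 w2 w3.
  move=> /and3P[+ _ _].
  have -> : pi ^+ n * pi ^+ b.+1 - 0 * X' + G' * (pi ^+ n * (- G * pi ^+ b.+1)
    - 0 * Y')
    = pi ^+ n * (pi ^+ b.+1 * (1 - G' * G)) by comring.
  rewrite -addnA dvp_cancel [(a.+1 + _)%N]addnC dvp_cancel =>
    /(dvp_le (ltn0Sn a)).
  by rewrite dvpDr ?dvpN ?dvpMl// dvp1_1.
have [c12 c13 c23] : [/\ c1 != c2, c1 != c3 & c2 != c3] by apply/and3P.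
have [c12' c13' c23'] : [/\ c1 != c2', c1 != c3' & c2' != c3'] by apply/and3P.
have [e2 e3] : c2 = c2' /\ c3 = c3'.
  have [e|e|e] := axisP c2 cd'; first by rewrite e eqxx in c12.
    have [f|f|f] := axisP c3 cd'; first by rewrite f eqxx in c13.
      by rewrite e f eqxx in c23.
    by [].
  have [f|f|f] := axisP c3 cd'; first by rewrite f eqxx in c13.
    exfalso; subst c2 c3; case: (ltngtP c2' c3') => [lt|lt|/val_inj e'].
    - by apply: (@swap c2' c3' x' y' g' x y g).
    - by apply: (@swap c3' c2' x y g x' y' g').
    - by rewrite e' eqxx in c23.
  by rewrite e f eqxx in c23.
subst c2' c3'.
pose v := vec (c1, c2, c3) (pi ^+ n) (pi ^+ n * x) (pi ^+ n * y).
have [v1 v2 v3] := vecE (pi ^+ n) (pi ^+ n * x) (pi ^+ n * y) cd.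
have : v \in lattice n a.+1 b.+1 (c1, c2, c3) x y g.
  apply/mem_latticeP; exists 1, 0, 0; rewrite v1 v2 v3; split; comring.
rewrite LL mem_lattice /form1 /form2 /form3/= v1 v2 v3 => /and3P[+ + _].
have -> : pi ^+ n * y - pi ^+ n * y' = pi ^+ n * (y - y') by comring.
have -> : pi ^+ n * x - pi ^+ n * x' + g' * (pi ^+ n * (y - y')) =
  pi ^+ n * (x - x' + g' * (y - y')) by comring.
rewrite -addnA !dvp_cancel => + /(reps_inj yr yr') ey; subst y'.
rewrite subrr mulr0 addr0 => /(reps_inj xr xr') ex; subst x'.
pose w := vec (c1, c2, c3) 0 (pi ^+ n * (- g * pi ^+ b.+1)) (pi ^+ n * pi ^+
  b.+1).
have [w1 w2 w3] := vecE 0 (pi ^+ n * (- g * pi ^+ b.+1)) (pi ^+ n * pi ^+ b.+1)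
  cd.
have : w \in lattice n a.+1 b.+1 (c1, c2, c3) x y g.
  apply/mem_latticeP; exists 0, 1, 0; rewrite w1 w2 w3; split; comring.
rewrite LL mem_lattice /form1 /form2 /form3/= w1 w2 w3 => /and3P[+ _ _].
have -> : pi ^+ n * (- g * pi ^+ b.+1) - 0 * x +
    g' * (pi ^+ n * pi ^+ b.+1 - 0 * y) = pi ^+ n * (pi ^+ b.+1 * (g' - g))
      by comring.
rewrite -addnA dvp_cancel [(a.+1 + _)%N]addnC dvp_cancel => gg.
by rewrite (reps_inj gr' gr gg).
Qed.

Lemma reduce_code n a b c x y g : admissible c x y g ->
  exists x' y' g', [/\ admissible c x' y' g',
    [/\ x' \in reps (a.+1 + b.+1), y' \in reps b.+1 & g' \in reps a.+1] &
    lattice n a.+1 b.+1 c x y g = lattice n a.+1 b.+1 c x' y' g'].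
Proof.
move=> adm; have [yr yy] := repP b.+1 y; set y' := rep _ y in yr yy.
(* [y] is reduced before [x], and [x] is shifted by the correction of [lattice_congr]. *)
have [xr xx] := repP (a.+1 + b.+1) (x + g * (y - y'));
  set x' := rep _ _ in xr xx.
have [gr gg] := repP a.+1 g; set g' := rep _ g in gr gg.
exists x', y', g'; split => //; last first.
  apply: lattice_congr => //.
  by have -> : x - x' + g * (y - y') = x + g * (y - y') - x' by comring.
have y1 : dvp 1 (y - y') by exact: dvp_le yy.
have g1 : dvp 1 (g - g') by exact: dvp_le gg.
have x1 : dvp 1 (x - x').
  have -> : x - x' = x + g * (y - y') - x' - g * (y - y') by comring.
  by apply: dvpB; [exact: dvp_le xx|exact: dvpMl].
case: c adm => [[c1 c2] c3].
by rewrite /admissible (dvp_congr x1) (dvp_congr y1) (dvp_congr g1).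
Qed.

(** * From three linear forms to a normal form *)

Definition form_eval (l : 'I_3 -> o) (z : o3 o) : o := \sum_k z k * l k.

Definition i0 : 'I_3 := @Ordinal 3 0 isT.
Definition i1 : 'I_3 := @Ordinal 3 1 isT.
Definition i2 : 'I_3 := @Ordinal 3 2 isT.

Lemma ord3P (k : 'I_3) : [\/ k = i0, k = i1 | k = i2].
Proof. by apply: axisP. Qed.

Lemma form_evalE c1 c2 c3 l z : distinct_axes (c1, c2, c3) ->
  form_eval l z = z c1 * l c1 + z c2 * l c2 + z c3 * l c3.
Proof.
move=> cd; rewrite /form_eval; move/and3P: (cd) => [c12 c13 c23].
rewrite (bigD1 c1)//= (bigD1 c2) 1?eq_sym//= (bigD1 c3)/=; last first.
  by rewrite eq_sym c13 eq_sym.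
rewrite big1 ?addr0 ?addrA// => k /andP[/andP[k1 k2] k3].
by have [k'|k'|k'] := axisP k cd; rewrite k' eqxx in k1 k2 k3.
Qed.

Definition minor (l1 l2 : 'I_3 -> o) (i j : 'I_3) : o :=
  l1 i * l2 j - l1 j * l2 i.

(* By Cramer's rule the vector [e_c1 + x e_c2 + y e_c3] spans the common kernel
   of [l1] and [l2], so all three forms are triangular in the coordinates of
   [z] relative to this vector. *)
Lemma forms_lattice n a b c1 c2 c3 (l1 l2 l3 : 'I_3 -> o) z :
  let d := minor l1 l2 c2 c3 in
  distinct_axes (c1, c2, c3) -> l1 c2 \is a GRing.unit -> d \is a GRing.unit ->
  ((0 < n)%N -> exists z, [/\ dvp 1 (form_eval l1 z), dvp 1 (form_eval l2 z)
      & dvp 1 (form_eval l3 z - 1)]) ->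
  [&& dvp (n + a + b) (form_eval l1 z), dvp (n + b) (form_eval l2 z)
    & dvp n (form_eval l3 z)] =
  (z \in lattice n a b (c1, c2, c3)
     (minor l1 l2 c3 c1 / d) (minor l1 l2 c1 c2 / d) (l1 c3 / l1 c2)).
Proof.
move=> d cd U1 Ud ex; set x := _ / d; set y := _ / d; set g := _ / l1 c2.
have xd : x * d = minor l1 l2 c3 c1 by rewrite divrK.
have yd : y * d = minor l1 l2 c1 c2 by rewrite divrK.
have gl : g * l1 c2 = l1 c3 by rewrite divrK.
have d0 : d != 0 by apply: contraTneq Ud => ->; rewrite unitr0.
pose A (z : o3 o) := z c2 - z c1 * x; pose B (z : o3 o) := z c3 - z c1 * y.
have E1 (z' : o3 o) : form_eval l1 z' = l1 c2 * (A z' + g * B z').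
  have -> : l1 c2 * (A z' + g * B z') = l1 c2 * A z' + g * l1 c2 * B z'
    by comring.
  apply: (mulfI d0); rewrite gl (form_evalE _ _ cd) /A /B.
  have -> : d * (l1 c2 * (z' c2 - z' c1 * x) + l1 c3 * (z' c3 - z' c1 * y)) =
    d * (z' c2 * l1 c2 + z' c3 * l1 c3) - z' c1 * (x * d * l1 c2 +
      y * d * l1 c3).
    by comring.
  by rewrite xd yd /d /minor; comring.
have E2 (z' : o3 o) : form_eval l2 z' = l2 c2 * A z' + l2 c3 * B z'.
  apply: (mulfI d0); rewrite (form_evalE _ _ cd) /A /B.
  have -> : d * (l2 c2 * (z' c2 - z' c1 * x) + l2 c3 * (z' c3 - z' c1 * y)) =
    d * (z' c2 * l2 c2 + z' c3 * l2 c3) - z' c1 * (x * d * l2 c2 +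
      y * d * l2 c3).
    by comring.
  by rewrite xd yd /d /minor; comring.
have E2' (z' : o3 o) : l1 c2 * form_eval l2 z' = l2 c2 * l1 c2 * (A z' +
  g * B z') + d * B z'.
  have -> : l2 c2 * l1 c2 * (A z' + g * B z') =
    l2 c2 * l1 c2 * A z' + l2 c2 * (g * l1 c2) * B z' by comring.
  by rewrite E2 gl /d /minor; comring.
(* The value of [l3] on the vector spanning the common kernel. For positive [n], the vector from the
   last hypothesis forces it to be a unit. *)
pose k := l3 c1 + x * l3 c2 + y * l3 c3.
have E3 (z' : o3 o) : form_eval l3 z' = l3 c2 * A z' + l3 c3 * B z' + z' c1 * k.
  by rewrite (form_evalE _ _ cd) /A /B /k; comring.
have BP m z' : dvp m (A z' + g * B z') -> dvp m (form_eval l2 z') =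
  dvp m (B z').
  move=> AB; rewrite -(dvp_unit _ _ U1) E2' addrC dvpDr; last exact: dvpMl.
  by rewrite (dvp_unit _ _ Ud).
have AP m z' : dvp m (A z' + g * B z') -> dvp m (B z') -> dvp m (A z').
  by move=> AB Bm; rewrite -(@dvpDr m _ (g * B z'))//; exact: dvpMl.
rewrite mem_lattice /form1 /form2 /form3/= -/(A z) -/(B z) E1 (dvp_unit _ _ U1).
case: (boolP (dvp (n + a + b) (A z + g * B z))) => //= AB.
have AB' : dvp (n + b) (A z + g * B z) by apply: dvp_le AB;
  rewrite leq_add2r leq_addr.
rewrite BP//; case: (boolP (dvp (n + b) (B z))) => //= Bz.
have {}AB' : dvp n (A z + g * B z) by apply: dvp_le AB'; rewrite leq_addr.
have {}Bz : dvp n (B z) by apply: dvp_le Bz; rewrite leq_addr.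
have Az := AP _ _ AB' Bz.
rewrite E3 addrC dvpDr; last by rewrite dvpD ?dvpMl.
have [->|n0] := posnP n; first by rewrite !dvp0.
have kU : k \is a GRing.unit.
  have [w []] := ex n0; rewrite E1 (dvp_unit _ _ U1) => ABw;
    rewrite (BP _ _ ABw) => Bw.
  rewrite E3 -[_ \is a _]negbK -dvp1E; apply: contraL => k1.
  rewrite addrC dvpDr ?dvpN ?dvp1_1//.
  by apply: dvpD; [apply: dvpD; apply: dvpMl => //; exact: AP|exact: dvpMl].
by rewrite mulrC (dvp_unit _ _ kU).
Qed.

Lemma minorC l1 l2 i j : minor l1 l2 i j = - minor l1 l2 j i.
Proof. by rewrite /minor; comring. Qed.

(** By the Cauchy-Binet formula a determinant congruent to 1 is a combination of the three
    minors. *)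
Lemma exists_unit_minor l1 l2 (z w : o3 o) :
  dvp 1 (form_eval l1 z - 1) -> dvp 1 (form_eval l2 z) ->
  dvp 1 (form_eval l1 w) -> dvp 1 (form_eval l2 w - 1) ->
  [|| ~~ dvp 1 (minor l1 l2 i1 i2), ~~ dvp 1 (minor l1 l2 i0 i2)
    | ~~ dvp 1 (minor l1 l2 i0 i1)].
Proof.
move=> z1 z2 w1 w2; rewrite -!negb_and; apply/negP => /and3P[m12 m02 m01].
have := dvp1_1; rewrite -(@dvp_congr 1 (form_eval l1 z * form_eval l2 w -
  form_eval l1 w * form_eval l2 z)) => [/negP|]; last first.
  have -> : form_eval l1 z * form_eval l2 w - form_eval l1 w * form_eval l2 z -
    1 =
   (form_eval l1 z - 1) * form_eval l2 w + (form_eval l2 w - 1)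
   - form_eval l1 w * form_eval l2 z by comring.
  by apply: dvpB; [apply: dvpD => //; exact: dvpMr|exact: dvpMr].
apply; rewrite !(@form_evalE i0 i1 i2)//.
set lhs := (X in dvp _ X).
have -> : lhs = (z i1 * w i2 - z i2 * w i1) * minor l1 l2 i1 i2 +
  (z i0 * w i2 - z i2 * w i0) * minor l1 l2 i0 i2 +
  (z i0 * w i1 - z i1 * w i0) * minor l1 l2 i0 i1.
  by rewrite /lhs /minor; comring.
by apply: dvpD; [apply: dvpD|]; exact: dvpMl.
Qed.

(** Up to sign, 1, [x] and [y] are the minors divided by a unit one, so the pivot [c1] is the first
    axis whose complementary minor is a unit. Of the other two axes, [c2] is the last one where [l1]
    is a unit; then [g] is a nonunit whenever [c2 < c3]. *)
Lemma exists_code n a b (l1 l2 l3 : 'I_3 -> o) :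
  (forall u1 u2 u3, exists z, [/\ dvp (n + a.+1 + b.+1) (form_eval l1 z - u1),
     dvp (n + b.+1) (form_eval l2 z - u2) & dvp n (form_eval l3 z - u3)]) ->
  exists c x y g, [/\ distinct_axes c, admissible c x y g &
    forall z, [&& dvp (n + a.+1 + b.+1) (form_eval l1 z),
      dvp (n + b.+1) (form_eval l2 z) & dvp n (form_eval l3 z)] =
    (z \in lattice n a.+1 b.+1 c x y g)].
Proof.
move=> surj.
have nab1 : (0 < n + a.+1 + b.+1)%N by rewrite addnS.
have nb1 : (0 < n + b.+1)%N by rewrite addnS.
have ex : (0 < n)%N -> exists z, [/\ dvp 1 (form_eval l1 z),
  dvp 1 (form_eval l2 z)
      & dvp 1 (form_eval l3 z - 1)].
  move=> n0; have [z [+ + z3]] := surj 0 0 1; rewrite !subr0 => z1 z2.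
  by exists z; split; [exact: dvp_le z1|exact: dvp_le z2|exact: dvp_le z3].
have step (c1 i j : 'I_3) : (i < j)%N -> distinct_axes (c1, i, j) ->
  ~~ dvp 1 (minor l1 l2 i j) ->
  (forall k : 'I_3, (k < c1)%N -> forall k', k' != k -> k' != c1 ->
    dvp 1 (minor l1 l2 c1 k')) ->
  exists c x y g, [/\ distinct_axes c, admissible c x y g &
    forall z, [&& dvp (n + a.+1 + b.+1) (form_eval l1 z),
      dvp (n + b.+1) (form_eval l2 z) & dvp n (form_eval l3 z)] =
    (z \in lattice n a.+1 b.+1 c x y g)].
  move=> ij cd mN small; move/and3P: (cd) => [c1i c1j inj].
  have mU : minor l1 l2 i j \is a GRing.unit
    by rewrite -[_ \is a _]negbK -dvp1E.
  have mVU : (minor l1 l2 i j)^-1 \is a GRing.unit by rewrite unitrV.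
  have [l1j|l1j] := boolP (dvp 1 (l1 j)).
    have l1i : l1 i \is a GRing.unit.
      rewrite -[_ \is a _]negbK -dvp1E; apply: contra mN => l1i.
      by apply: dvpB; [exact: dvpMr|exact: dvpMr].
    exists (c1, i, j); do 3 eexists; split; [exact: cd| |move=> z;
      exact: forms_lattice].
    apply/and3P; split; apply/implyP => h.
    - by rewrite dvpMr// minorC dvpN (small i)// eq_sym.
    - by rewrite dvpMr// (small j)// eq_sym.
    - by rewrite dvpMr.
  have cd' : distinct_axes (c1, j, i) by rewrite /= c1j c1i eq_sym inj.
  have mU' : minor l1 l2 j i \is a GRing.unit by rewrite minorC unitrN.
  have l1U : l1 j \is a GRing.unit by rewrite -[_ \is a _]negbK -dvp1E.
  exists (c1, j, i); do 3 eexists; split; [exact: cd'| |move=> z;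
    exact: forms_lattice].
  apply/and3P; split; apply/implyP => h.
  - by rewrite dvpMr// minorC dvpN (small j)// eq_sym.
  - by rewrite dvpMr// (small i)// eq_sym.
  - by rewrite ltnNge ltnW in h.
have [z [z1 z2 _]] := surj 1 0 0; have [w [w1 w2 _]] := surj 0 1 0.
rewrite subr0 in z2; rewrite subr0 in w1.
have := exists_unit_minor (dvp_le nab1 z1) (dvp_le nb1 z2) (dvp_le nab1 w1)
  (dvp_le nb1 w2).
case: (boolP (dvp 1 (minor l1 l2 i1 i2))) => [m12 /=|m12 _]; last first.
  by apply: (step i0 i1 i2) => // -[].
case: (boolP (dvp 1 (minor l1 l2 i0 i2))) => [m02 /=|m02 _]; last first.
  apply: (step i1 i0 i2) => // k k1 k'.
  have -> : k = i0 by apply: val_inj; case: k k1 => [[]].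
  by have [->|->|->] := ord3P k'.
move=> m01; apply: (step i2 i0 i1) => // k k1 k'.
by have [->|->|->] := ord3P k' => //; rewrite minorC dvpN.
Qed.

(** * Quotients by lattices in normal form *)

Definition cyclic_proj k (x : o) : cyclic_module pi k :=
  \pi_(quotient_module (principal_ideal (pi ^+ k))) x.

Lemma cyclic_proj_eq k x y : cyclic_proj k x = cyclic_proj k y <->
  dvp k (x - y).
Proof. exact: (quotient_piP (principal_ideal (pi ^+ k)) x y). Qed.

Lemma cyclic_proj_eq0 k x : cyclic_proj k x = 0 <-> dvp k x.
Proof.
have := cyclic_proj_eq k x 0; rewrite subr0.
by rewrite [X in _ = X <-> _](quotient_pi0 (principal_ideal (pi ^+ k))).
Qed.

Lemma cyclic_projD k x y : cyclic_proj k (x + y) = cyclic_proj k x +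
  cyclic_proj k y.
Proof. exact: (quotient_piD (principal_ideal (pi ^+ k)) x y). Qed.

Lemma cyclic_projZ k a x : cyclic_proj k (a * x) = a *: cyclic_proj k x.
Proof. exact: (quotient_pi_scale (principal_ideal (pi ^+ k)) a x). Qed.

Lemma cyclic_proj_surj k (w : cyclic_module pi k) : exists x, cyclic_proj k x =
  w.
Proof. by exists (repr w); rewrite /cyclic_proj reprK. Qed.

Local Notation cyclic_triple n a b :=
  (cyclic_module pi (n + a + b) * cyclic_module pi (n + b) * cyclic_module pi
    n)%type.

Lemma cyclic_finite k : finite_set [set: cyclic_module pi k].
Proof.
apply: (@sub_finite_set _ _ [set` [seq cyclic_proj k x | x <- reps k]]) =>
  [w _|].
  have [x <-] := cyclic_proj_surj w; have [r rk xr] := reps_rep k x.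
  by rewrite ((cyclic_proj_eq k x r).2 xr) /=; exact: map_f.
exact: finite_seq.
Qed.

Lemma lattice_quotient n a b c x y g : distinct_axes c ->
  isomorphic_modules (quotient_module (lattice n a b c x y g)) (cyclic_triple n
    a b).
Proof.
case: c => [[c1 c2] c3] cd; apply/isomorphic_quotientP.
pose phi (z : o3 o) : cyclic_triple n a b :=
  (cyclic_proj (n + a + b) (form1 (c1, c2, c3) x y g z),
   cyclic_proj (n + b) (form2 (c1, c2, c3) y z),
   cyclic_proj n (form3 (c1, c2, c3) z)).
have phi_lin : linear phi.
  move=> r u v; set c := (c1, c2, c3) in cd phi *.
  have P N s t : cyclic_proj N (r * s + t) = r *: cyclic_proj N s +
    cyclic_proj N t.
    by rewrite cyclic_projD cyclic_projZ.
  transitivity (r *: cyclic_proj (n + a + b) (form1 c x y g u)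
      + cyclic_proj (n + a + b) (form1 c x y g v),
    r *: cyclic_proj (n + b) (form2 c y u) + cyclic_proj (n + b) (form2 c y v),
    r *: cyclic_proj n (form3 c u) + cyclic_proj n (form3 c v)); last by [].
  have E k : (r *: u + v) k = r * u k + v k by rewrite !ffunE.
  rewrite -!P /phi /form1 /form2 /form3/= !E.
  by congr (_, _, _); congr cyclic_proj; comring.
pose phiL : {linear o3 o -> cyclic_triple n a b} :=
  HB.pack phi (GRing.isLinear.Build _ _ _ _ phi phi_lin).
exists phiL; split=> [[[w1 w2] w3]|z] /=.
  have [u1 <-] := cyclic_proj_surj w1; have [u2 <-] := cyclic_proj_surj w2.
  have [u3 <-] := cyclic_proj_surj w3.
  (* The vector [u3 v + u2 w + u1 e_c2]. *)
  exists (vec (c1, c2, c3) u3 (u1 + u3 * x - g * u2) (u2 + u3 * y)).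
  have [e1 e2 e3] := vecE u3 (u1 + u3 * x - g * u2) (u2 + u3 * y) cd.
  rewrite /phi /form1 /form2 /form3/= e1 e2 e3.
  by congr (_, _, _); congr cyclic_proj; comring.
rewrite mem_lattice /phi; split=> [[/cyclic_proj_eq0 -> /cyclic_proj_eq0 ->
  /cyclic_proj_eq0 ->]//|].
by move=> /and3P[/cyclic_proj_eq0 -> /cyclic_proj_eq0 -> /cyclic_proj_eq0 ->].
Qed.

(** Lifting the images of the standard basis vectors to [o] turns the quotient map into three linear
    forms, whose joint surjectivity is the input of [exists_code]. *)
Lemma quotient_lattice n a b (L : submodule (o3 o)) :
  isomorphic_modules (quotient_module L) (cyclic_triple n a.+1 b.+1) ->
  exists c x y g, [/\ distinct_axes c, admissible c x y g &
    L = lattice n a.+1 b.+1 c x y g].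
Proof.
move=> /isomorphic_quotientP[phi [phi_surj phiL]].
pose e (k : 'I_3) : o3 o := [ffun j => (j == k)%:R].
pose l1 k := repr (phi (e k)).1.1; pose l2 k := repr (phi (e k)).1.2.
pose l3 k := repr (phi (e k)).2.
have phiE z : phi z = (cyclic_proj _ (form_eval l1 z),
  cyclic_proj _ (form_eval l2 z),
   cyclic_proj _ (form_eval l3 z)).
  have zE : z = z i0 *: e i0 + z i1 *: e i1 + z i2 *: e i2.
    apply/ffunP => k; rewrite !ffunE.
    by have [->|->|->] := ord3P k;
      rewrite /= ?scaler0 ?addr0 ?add0r /GRing.scale/= ?mulr1 ?mulr0 ?addr0
        ?add0r.
  have R k : phi (e k) = (cyclic_proj _ (l1 k), cyclic_proj _ (l2 k),
    cyclic_proj _ (l3 k)).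
    by rewrite /cyclic_proj /l1 /l2 /l3 !reprK; case: (phi (e k)) => [[]].
  rewrite !(@form_evalE i0 i1 i2)// !cyclic_projD !cyclic_projZ.
  by rewrite {1}zE !linearD !linearZ/= !R.
have surj u1 u2 u3 : exists z, [/\ dvp (n + a.+1 + b.+1) (form_eval l1 z - u1),
     dvp (n + b.+1) (form_eval l2 z - u2) & dvp n (form_eval l3 z - u3)].
  have [z] := phi_surj (cyclic_proj _ u1, cyclic_proj _ u2, cyclic_proj _ u3).
  by rewrite phiE => -[/cyclic_proj_eq z1 /cyclic_proj_eq z2 /cyclic_proj_eq
    z3]; exists z.
have [c [x [y [g [cd adm E]]]]] := exists_code surj.
exists c, x, y, g; split=> //; apply: submodule_eq => z; rewrite -E.
apply/idP/and3P => [/phiL|[z1 z2 z3]].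
  by rewrite phiE => -[/cyclic_proj_eq0 z1 /cyclic_proj_eq0 z2 /cyclic_proj_eq0
    z3].
apply/phiL; rewrite phiE.
by move: z1 z2 z3 => /cyclic_proj_eq0 -> /cyclic_proj_eq0 ->
  /cyclic_proj_eq0 ->.
Qed.

Lemma lattice_finite n a b c x y g : distinct_axes c ->
  finite_set [set: quotient_module (lattice n a b c x y g)].
Proof.
move=> /(lattice_quotient n a b x y g)[f [h fK hK]].
have fin : finite_set [set: cyclic_triple n a b].
  by rewrite -!setXTT; do 2?[apply: finite_setX]; exact: cyclic_finite.
apply: (sub_finite_set _ (finite_image h fin)) => v _.
by exists (f v).
Qed.

(** * Enumeration of the codes *)

Definition axis_orders : seq axis_order :=
  [:: (i0, i1, i2); (i0, i2, i1); (i1, i0, i2); (i1, i2, i0); (i2, i0, i1);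
    (i2, i1, i0)].

Lemma mem_axis_orders c : (c \in axis_orders) = distinct_axes c.
Proof.
by case: c => [[c1 c2] c3]; have [->|->|->] := ord3P c1;
  have [->|->|->] := ord3P c2; have [->|->|->] := ord3P c3.
Qed.

Lemma sum_admissible x y g :
  \sum_(c <- axis_orders) (admissible c x y g)%:R = multiplicity x y g.
Proof.
rewrite /axis_orders !big_cons big_nil /admissible/= /multiplicity /nonunit.
by case: (dvp 1 x); case: (dvp 1 y); case: (dvp 1 g) => /=; comring.
Qed.

Definition all_codes a b : seq ((axis_order * o) * (o * o)) :=
  [seq (cy, gx) | cy <- [seq (c, y) | c <- axis_orders, y <- reps b],
                  gx <- [seq (g, x) | g <- reps a, x <- reps (a + b)]].

Definition codes n a b :=
  [seq u <- all_codes a b | admissible u.1.1 u.2.2 u.1.2 u.2.1 &&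
                            closed_code n a b u.2.2 u.1.2 u.2.1].

Definition code_lattice n a b (u : (axis_order * o) * (o * o)) :
  submodule (o3 o) :=
  lattice n a b u.1.1 u.2.2 u.1.2 u.2.1.

Lemma mem_codes n a b u : u \in codes n a b ->
  [/\ distinct_axes u.1.1, admissible u.1.1 u.2.2 u.1.2 u.2.1,
      closed_code n a b u.2.2 u.1.2 u.2.1 &
      [/\ u.2.2 \in reps (a + b), u.1.2 \in reps b & u.2.1 \in reps a]].
Proof.
rewrite mem_filter => /andP[/andP[adm cl]].
move=> /allpairsP[[cy gx] [/allpairsP[[c y] [cO yr cyE]]]].
move=> /allpairsP[[g x] [gr xr gxE]] uE; rewrite /= in cO yr cyE gr xr gxE uE.
by rewrite uE cyE gxE/= in adm cl *; rewrite -mem_axis_orders.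
Qed.

Lemma uniq_codes n a b : uniq (codes n a b).
Proof.
apply: filter_uniq; apply: allpairs_uniq => [||[? ?] [? ?] _ _ [-> ->]//].
  by apply: allpairs_uniq; rewrite ?uniq_reps// => -[? ?] [? ?] _ _ [-> ->].
by apply: allpairs_uniq; rewrite ?uniq_reps// => -[? ?] [? ?] _ _ [-> ->].
Qed.

(** Being closed does not depend on the axis order, so summing over the orders innermost replaces
    admissibility by [multiplicity]. *)
Lemma size_codes n a b : (size (codes n a b))%:R = total_sum n a b.
Proof.
rewrite -sum1_size natr_sum big_filter big_mkcond !big_allpairs/=
  exchange_big/=.
apply: eq_bigr => y _; rewrite /code_sum.
rewrite (eq_bigr (fun c => \sum_(g <- reps a) \sum_(x <- reps (a + b))
   if admissible c x y g && closed_code n a b x y g then 1 else 0)); last first.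
  by move=> c _; rewrite big_allpairs.
rewrite exchange_big/=; apply: eq_bigr => g _;
  rewrite exchange_big/= [RHS]big_mkcond/=.
apply: eq_bigr => x _; case: ifP => cl; last by rewrite big1// => c;
  rewrite andbF.
rewrite -sum_admissible; apply: eq_bigr => c _; rewrite andbT.
by case: admissible.
Qed.

Lemma subalgebras_of_typeE n a b :
  subalgebras_of_type pi n a.+1 b.+1 =
  [set` [seq code_lattice n a.+1 b.+1 u | u <- codes n a.+1 b.+1]]%classic.
Proof.
apply/seteqP; split => L /=.
  move=> [[_ Lmul]] /quotient_lattice[c [x [y [g [cd adm LE]]]]].
  have [x' [y' [g' [adm' [xr yr gr] E]]]] := reduce_code n a b adm.
  rewrite {}E in LE; rewrite {}LE in Lmul *.
  apply/mapP; exists ((c, y'), (g', x')) => //.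
  rewrite mem_filter /= adm'/=; apply/andP; split.
    by case: c Lmul cd {adm adm'} => [[c1 c2] c3] Lmul cd;
      apply/(lattice_mul_closed _ _ _ _ _ _ cd).
  by apply: allpairs_f; apply: allpairs_f; rewrite ?mem_axis_orders.
move=> /mapP[u /mem_codes[cd _ cl _] ->]; split; last exact: lattice_quotient.
split; first exact: lattice_finite.
rewrite /code_lattice; case: u.1.1 cd => [[c1 c2] c3] cd.
by apply/(lattice_mul_closed _ _ _ _ _ _ cd).
Qed.

Lemma h3E n a b : (h3 pi n a.+1 b.+1)%:R = total_sum n a.+1 b.+1.
Proof.
rewrite -size_codes -(size_map (code_lattice n a.+1 b.+1)); congr _%:R.
rewrite /h3 subalgebras_of_typeE; set s := map _ _.
have -> : [set` s]%classic = [set` [fset L in s]%fset]%classic.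
  by apply/seteqP; split=> L /=; rewrite inE.
rewrite set_fsetK card_fseq undup_id// map_inj_in_uniq ?uniq_codes//.
move=> [[c y] [g x]] [[c' y'] [g' x']] /mem_codes/= [cd adm _ [xr yr gr]].
move=> /mem_codes/= [cd' adm' _ [xr' yr' gr']] E.
by have [-> -> -> ->] := lattice_inj cd cd' adm adm' xr xr' yr yr' gr gr' E.
Qed.

End CompactDvr.

(** * Generating functions *)

Section FpsCoefficients.
Variable R : comNzRingType.
Implicit Types f g : fps R.

Lemma coefs_const_mul c f n : coefs (fps_const c * f) n = c * coefs f n.
Proof.
rewrite [LHS]big_ord_recl/= subn0 big1 ?addr0// => i _; exact: mul0r.
Qed.

Lemma coefs_var_mul f n :
  coefs (fps_var R * f) n = if n is n'.+1 then coefs f n' else 0.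
Proof.
case: n => [|n]; first by rewrite [LHS]big_ord1/= mul0r.
rewrite [LHS]big_ord_recl [X in X + _]mul0r add0r big_ord_recl/=.
by rewrite mul1r subSS subn0 big1 ?addr0// => i _; exact: mul0r.
Qed.

Lemma coefs0M f g : coefs (f * g) 0 = coefs f 0 * coefs g 0.
Proof. exact: big_ord1. Qed.

Lemma fps_constD c d : fps_const (c + d) = fps_const c + fps_const d :> fps R.
Proof. by apply/fpsP => -[|n] /=; rewrite ?addr0. Qed.

Lemma fps_constM c d : fps_const (c * d) = fps_const c * fps_const d :> fps R.
Proof. by apply/fpsP => -[|n]; rewrite coefs_const_mul//= mulr0. Qed.

Lemma fps_const_nat m : fps_const m%:R = m%:R :> fps R.
Proof.
elim: m => [|m IH]; first by apply/fpsP => -[].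
by rewrite -addn1 !natrD fps_constD IH.
Qed.

End FpsCoefficients.

Section GeneratingFunctions.
Variable K : comNzRingType.
Local Notation series := (fps (fps (fps K))).
Local Notation X := (fps_const (fps_const (fps_var K)) : series).
Local Notation U := (fps_const (fps_var (fps K)) : series).
Local Notation V := (fps_var (fps (fps K)) : series).
Implicit Types f g : nat -> nat -> nat -> K.

Definition gf f : series :=
  Fps (fun b => Fps (fun a => Fps (fun n => f n a b))).

Definition scalar (c : K) : series := fps_const (fps_const (fps_const c)).

Definition shiftX f n a b := if n is n'.+1 then f n' a b else 0.
Definition shiftU f n a b := if a is a'.+1 then f n a' b else 0.
Definition shiftV f n a b := if b is b'.+1 then f n a b' else 0.

Lemma eq_gf f g : (forall n a b, f n a b = g n a b) -> gf f = gf g.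
Proof. by move=> fg; apply/fpsP => b; apply/fpsP => a; apply/fpsP => n;
  exact: fg. Qed.

Lemma gfD f g : gf (fun n a b => f n a b + g n a b) = gf f + gf g.
Proof. by apply/fpsP => b; apply/fpsP => a; apply/fpsP => n. Qed.

Lemma gfZ c f : gf (fun n a b => c * f n a b) = scalar c * gf f.
Proof.
by apply/fpsP => b; rewrite coefs_const_mul; apply/fpsP => a;
  rewrite coefs_const_mul; apply/fpsP => n; rewrite coefs_const_mul.
Qed.

Lemma gf_shiftX f : gf (shiftX f) = X * gf f.
Proof.
by apply/fpsP => b; rewrite coefs_const_mul; apply/fpsP => a;
  rewrite coefs_const_mul; apply/fpsP => n; rewrite coefs_var_mul; case: n.
Qed.

Lemma gf_shiftU f : gf (shiftU f) = U * gf f.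
Proof.
apply/fpsP => b; rewrite coefs_const_mul; apply/fpsP => a.
by rewrite coefs_var_mul; apply/fpsP => n; case: a => //; case: n.
Qed.

Lemma gf_shiftV f : gf (shiftV f) = V * gf f.
Proof.
apply/fpsP => b; rewrite coefs_var_mul; apply/fpsP => a.
by apply/fpsP => n; case: b => //; case: a; case: n.
Qed.

Lemma scalarD c d : scalar (c + d) = scalar c + scalar d.
Proof. by rewrite /scalar !fps_constD. Qed.

Lemma scalarM c d : scalar (c * d) = scalar c * scalar d.
Proof. by rewrite /scalar !fps_constM. Qed.

Lemma scalar_nat m : scalar m%:R = m%:R.
Proof. by rewrite /scalar !fps_const_nat. Qed.

Lemma scalarX c m : scalar (c ^+ m) = scalar c ^+ m.
Proof.
elim: m => [|m IH]; first by rewrite !expr0 (scalar_nat 1).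
by rewrite !exprS scalarM IH.
Qed.

Definition delta (c : K) n a b : K := if (n, a, b) is (0, 0, 0)%N then c else 0.

Lemma gf_delta c : gf (delta c) = scalar c.
Proof. by apply/fpsP => -[|b]; apply/fpsP => -[|a]; apply/fpsP => -[|n]. Qed.

(** Summation along one edge of a cone: translation along the edge multiplies [f] by [w], and [g] is
    what remains of [f] on the part of the cone that no translate reaches. *)
Lemma gf_geometric
    (S : (nat -> nat -> nat -> K) -> nat -> nat -> nat -> K) M w f g :
  (forall h, gf (S h) = M * gf h) ->
  (forall n a b, f n a b = g n a b + w * S f n a b) ->
  gf f * (1 - scalar w * M) = gf g.
Proof.
move=> SM fg; have -> : gf f * (1 - scalar w * M) = gf f - scalar w *
  (M * gf f).
  by comring.
rewrite -SM -gfZ; apply/eqP; rewrite subr_eq -gfD; apply/eqP/eq_gf => n a b.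
exact: fg.
Qed.

Definition shiftXU f := shiftX (shiftU f).
Definition shiftXV f := shiftX (shiftV f).
Definition shiftUV f := shiftU (shiftV f).
Definition shiftXUV f := shiftX (shiftU (shiftV f)).

Lemma gf_shiftXU f : gf (shiftXU f) = X * U * gf f.
Proof. by rewrite gf_shiftX gf_shiftU mulrA. Qed.

Lemma gf_shiftXV f : gf (shiftXV f) = X * V * gf f.
Proof. by rewrite gf_shiftX gf_shiftV mulrA. Qed.

Lemma gf_shiftUV f : gf (shiftUV f) = U * V * gf f.
Proof. by rewrite gf_shiftU gf_shiftV mulrA. Qed.

Lemma gf_shiftXUV f : gf (shiftXUV f) = X * U * V * gf f.
Proof. by rewrite gf_shiftX gf_shiftU gf_shiftV !mulrA. Qed.

(** * Series of the pieces supported on cones *)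

Variable q : nat.
Local Notation Q := (q%:R : K).

Definition cut (P : nat -> nat -> nat -> bool) f n a b : K :=
  if P n a b then f n a b else 0.

Ltac unfold_shifts :=
  rewrite /cut /shiftXU /shiftXV /shiftUV /shiftXUV /shiftX /shiftU /shiftV
    /delta /=;
  repeat (case: ifP => ? /=); try lia; rewrite ?exprS ?expr0;
  by comring.

Ltac shift_cases :=
  let n := fresh "n" in let a := fresh "a" in let b := fresh "b" in
  move=> n a b; case: n a b => [|n] [|a] [|b]; unfold_shifts.

(** Finer than [shift_cases], for last steps that leave a single point away from the origin. *)
Ltac shift_cases2 :=
  let n := fresh "n" in let a := fresh "a" in let b := fresh "b" in
  move=> n a b; case: n a b => [|[|[|n]]] [|[|a]] [|[|b]]; unfold_shifts.

(* The six summands of [h3 n a.+1 b.+1], by the relative position of [n], [a],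
   [b]. Each one but [f_branch] is supported on a cone and multiplied by a
   constant under translation along the edges of that cone. *)
Definition f_free := cut (fun n a b => (a.+1 + b.+1 <= n)%N)
  (fun n a b => (Q + 1) * (Q ^+ 2 + Q + 1) * Q * (Q ^+ a * Q ^+ b) ^+ 2).

Local Notation A := (scalar (Q ^+ 2) * (X * U)).
Local Notation B := (scalar (Q ^+ 2) * (X * V)).
Local Notation W := (scalar Q * (U * V)).
Local Notation D := (scalar (Q ^+ 3) * (X * U * V)).

Lemma gf_geometric1 S M f g : (forall h, gf (S h) = M * gf h) ->
  (forall n a b, f n a b = g n a b + S f n a b) -> gf f * (1 - M) = gf g.
Proof.
move=> SM fg; have -> : 1 - M = 1 - scalar 1%:R * M by rewrite scalar_nat mul1r.
by apply: gf_geometric SM _ => n a b; rewrite mul1r.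
Qed.

(** The cone has apex [X^2] and edges [X], [X U], [X V], along which the function grows by 1, [q^2],
    [q^2]. *)
Lemma gf_free : gf f_free * (1 - X) * (1 - A) * (1 - B) =
  X * (X * scalar ((Q + 1) * (Q ^+ 2 + Q + 1) * Q)).
Proof.
pose F (n a b : nat) := (Q + 1) * (Q ^+ 2 + Q + 1) * Q * (Q ^+ a * Q ^+ b) ^+ 2.
pose f1 := cut (fun n a b => (n == a.+1 + b.+1)%N) F.
pose f2 := cut (fun n a b => (n == b.+2) && (a == 0)) F.
pose f3 := shiftX (shiftX (delta ((Q + 1) * (Q ^+ 2 + Q + 1) * Q))).
have s1 : gf f_free * (1 - X) = gf f1.
  by apply: gf_geometric1 gf_shiftX _; rewrite /f_free /f1 /F; shift_cases.
have s2 : gf f1 * (1 - A) = gf f2.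
  by apply: gf_geometric gf_shiftXU _; rewrite /f1 /f2 /F; shift_cases.
have s3 : gf f2 * (1 - B) = gf f3.
  by apply: gf_geometric gf_shiftXV _; rewrite /f3 /f2 /F; shift_cases2.
by rewrite s1 s2 s3 !gf_shiftX gf_delta.
Qed.

(** The factor is [(Q - 2) (Q + 3) + 4 (Q + 1) + 3 (Q + 1)]: for [a < n] the branch sum is a single
    product and is included here. *)
Definition f_small := cut (fun n a b => [&& a < n, b < n & n < a.+1 + b.+1]%N)
  (fun n a b => (Q ^+ 2 + 8 * Q + 1) * (Q ^+ a * Q ^+ b * Q ^+ n)).

Lemma gf_small : gf f_small * (1 - A) * (1 - B) * (1 - D) =
  X * scalar ((Q ^+ 2 + 8 * Q + 1) * Q).
Proof.
pose F (n a b : nat) := (Q ^+ 2 + 8 * Q + 1) * (Q ^+ a * Q ^+ b * Q ^+ n).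
pose f1 := cut (fun n a b => (n == b.+1) && (a <= b)%N) F.
pose f2 := cut (fun n a b => (n == b.+1) && (a == b)) F.
pose f3 := shiftX (delta ((Q ^+ 2 + 8 * Q + 1) * Q)).
have s1 : gf f_small * (1 - A) = gf f1.
  by apply: gf_geometric gf_shiftXU _; rewrite /f_small /f1 /F; shift_cases.
have s2 : gf f1 * (1 - B) = gf f2.
  by apply: gf_geometric gf_shiftXV _; rewrite /f1 /f2 /F; shift_cases.
have s3 : gf f2 * (1 - D) = gf f3.
  by apply: gf_geometric gf_shiftXUV _; rewrite /f3 /f2 /F; shift_cases2.
by rewrite s1 s2 s3 gf_shiftX gf_delta.
Qed.

Definition f_wide := cut (fun n a b => (a < n <= b)%N)
  (fun n a b => 7 * (Q + 1) * (Q ^+ n * Q ^+ n * Q ^+ a)).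

Lemma gf_wide : gf f_wide * (1 - V) * (1 - B) * (1 - D) =
  X * (V * scalar (7 * (Q + 1) * Q ^+ 2)).
Proof.
pose F (n a b : nat) := 7 * (Q + 1) * (Q ^+ n * Q ^+ n * Q ^+ a).
pose f1 := cut (fun n a b => (n == b) && (a < n)%N) F.
pose f2 := cut (fun n a b => (n == b) && (n == a.+1)) F.
pose f3 := shiftX (shiftV (delta (7 * (Q + 1) * Q ^+ 2))).
have s1 : gf f_wide * (1 - V) = gf f1.
  by apply: gf_geometric1 gf_shiftV _; rewrite /f_wide /f1 /F; shift_cases.
have s2 : gf f1 * (1 - B) = gf f2.
  by apply: gf_geometric gf_shiftXV _; rewrite /f1 /f2 /F; shift_cases.
have s3 : gf f2 * (1 - D) = gf f3.
  by apply: gf_geometric gf_shiftXUV _; rewrite /f3 /f2 /F; shift_cases2.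
by rewrite s1 s2 s3 gf_shiftX gf_shiftV gf_delta.
Qed.

(** The factor is [6 (Q - 2) + 6]; the branch sum, now a genuine sum, is left to [f_branch]. *)
Definition f_tall := cut (fun n a b => (b < n <= a)%N)
  (fun n a b => 6 * (Q - 1) * (Q ^+ n * Q ^+ n * Q ^+ b)).

Lemma gf_tall : gf f_tall * (1 - U) * (1 - A) * (1 - D) =
  X * (U * scalar (6 * (Q - 1) * Q ^+ 2)).
Proof.
pose F (n a b : nat) := 6 * (Q - 1) * (Q ^+ n * Q ^+ n * Q ^+ b).
pose f1 := cut (fun n a b => (n == a) && (b < n)%N) F.
pose f2 := cut (fun n a b => (n == a) && (n == b.+1)) F.
pose f3 := shiftX (shiftU (delta (6 * (Q - 1) * Q ^+ 2))).
have s1 : gf f_tall * (1 - U) = gf f1.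
  by apply: gf_geometric1 gf_shiftU _; rewrite /f_tall /f1 /F; shift_cases.
have s2 : gf f1 * (1 - A) = gf f2.
  by apply: gf_geometric gf_shiftXU _; rewrite /f1 /f2 /F; shift_cases.
have s3 : gf f2 * (1 - D) = gf f3.
  by apply: gf_geometric gf_shiftXUV _; rewrite /f3 /f2 /F; shift_cases2.
by rewrite s1 s2 s3 gf_shiftX gf_shiftU gf_delta.
Qed.

Definition f_large := cut (fun n a b => (n <= a) && (n <= b))%N
  (fun n a b => 6 * (Q ^+ n * Q ^+ n * Q ^+ n)).

Lemma gf_large : gf f_large * (1 - D) * (1 - U) * (1 - V) = scalar 6.
Proof.
pose F (n a b : nat) := 6 * (Q ^+ n * Q ^+ n * Q ^+ n).
pose f1 := cut (fun n a b => n == 0)%N F.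
pose f2 := cut (fun n a b => (n == 0) && (a == 0))%N F.
have s1 : gf f_large * (1 - D) = gf f1.
  by apply: gf_geometric gf_shiftXUV _; rewrite /f_large /f1 /F; shift_cases.
have s2 : gf f1 * (1 - U) = gf f2.
  by apply: gf_geometric1 gf_shiftU _; rewrite /f1 /f2 /F; shift_cases.
have s3 : gf f2 * (1 - V) = gf (delta 6).
  by apply: gf_geometric1 gf_shiftV _; rewrite /f2 /F; shift_cases.
by rewrite s1 s2 s3 gf_delta.
Qed.

(** * The series of the branch sums *)

Local Notation weight := (valuation_weight q K).
Local Notation branch := (branch_sum q K).

Lemma weightS i : weight i.+1 = Q * weight i - (i == 0)%:R.
Proof. by case: i => [|i] /=; rewrite ?exprS ?expr0; comring. Qed.

Lemma sum_weight n b : \sum_(i < b.+1 | (i <= n)%N) weight i = Q ^+ minn n b.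
Proof.
elim: b => [|b IH].
  by rewrite big_mkcond big_ord1/= minn0.
rewrite big_mkcond big_ord_recr/= -big_mkcond/= IH.
case: ifP => h; last by rewrite addr0; congr (_ ^+ _); lia.
by rewrite (minn_idPr (ltnW h)) (minn_idPr h) exprS; comring.
Qed.

Lemma branch_small n a b : (a <= n)%N ->
  branch n a b = Q ^+ minn n b * (Q ^+ a.+1 + Q ^+ a).
Proof.
move=> an; rewrite -sum_weight mulr_suml; apply: eq_bigr => i _.
by rewrite ifT// (leq_trans an) ?leq_addr.
Qed.

(** The term [i = 0] of [branch_sum], where [y] is congruent to 0 or 1 to full precision. *)
Definition branch0 n a b : K :=
  if (a <= n + b)%N then Q ^+ a.+1 + Q ^+ a else 3 * Q ^+ (n + b).+1.

Lemma branch_0 n a b : (n == 0)%N || (b == 0)%N -> branch n a b = branch0 n a b.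
Proof.
move=> nb; rewrite /branch_sum big_mkcond big_ord_recl/= mul1r subn0.
rewrite big1 ?addr0// => i _.
by case: ifP => // h; case/orP: nb => /eqP e; subst; case: i h => [].
Qed.

(** Under [i] to [i.+1] each value is multiplied by [Q], and so is each weight except that the
    passage from 0 to 1 loses 1; this loss is the term [- Q * branch0 n a b]. *)
Lemma branch_rec n a b : branch n.+1 a.+1 b.+1 =
  branch0 n.+1 a.+1 b.+1 + Q ^+ 2 * branch n a b - Q * branch0 n a b.
Proof.
rewrite {1}/branch_sum big_mkcond big_ord_recl/= mul1r subn0 -addrA;
  congr (_ + _).
pose k i := if (a <= n + (b - i))%N then Q ^+ a.+1 + Q ^+ a else 3 * Q ^+
  (n + (b - i)).+1.
transitivity (\sum_(i < b.+1) Q * ((if (i <= n)%N then Q * (weight i * k i)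
  else 0)
   - (nat_of_ord i == 0)%:R * k i)).
  apply: eq_bigr => i _; rewrite /bump/= add1n ltnS subSS addSn ltnS.
  rewrite -[(Q - 1) * _]/(weight i.+1) weightS /k.
  case: (leqP i n) => h; last first.
    by case: (nat_of_ord i) h => // j _ /=; comring.
  by case: ifP => _; rewrite !exprS; case: (nat_of_ord i == 0)%N => /=; comring.
rewrite -mulr_sumr sumrB -big_mkcond -mulr_sumr.
rewrite [\sum_(i < _ | _) _](_ : _ = branch n a b)//.
have -> : \sum_(i < b.+1) (nat_of_ord i == 0)%:R * k i = branch0 n a b.
  rewrite big_ord_recl big1 => [|i _]; last by rewrite mul0r.
  by rewrite mul1r addr0 /k subn0.
by comring.
Qed.

Definition f_branch := cut (fun n a b => (n <= a)%N) (fun n a b =>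
  4 * Q ^+ n * branch n a b).
Definition f_branch0 := cut (fun n a b => (n <= a)%N) (fun n a b =>
  4 * Q ^+ n * branch0 n a b).

(* The weights [1, q - 1, (q - 1) q, ...] have generating series [(1 - t) / (1
   - q t)], which turns the sum over [i] into the quotient of the factors [1 -
   q^2 X U V] and [1 - q^3 X U V]. *)
Lemma gf_branch : gf f_branch * (1 - D) =
  gf f_branch0 * (1 - scalar (Q ^+ 2) * (X * U * V)).
Proof.
pose g n a b := f_branch0 n a b + (- Q ^+ 2) * shiftXUV f_branch0 n a b.
have -> : gf f_branch * (1 - D) = gf g.
  apply: gf_geometric gf_shiftXUV _ => n a b;
    rewrite /g /f_branch /f_branch0 /cut.
  case: n a b => [|n] [|a] [|b];
    rewrite /shiftXUV /shiftX /shiftU /shiftV ?(branch_0 _ (n:=0%N))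
      ?(branch_0 _ (b:=0%N))//=.
  all: try by [comring|case: ifP => _; comring].
  by rewrite ?ltnS; case: ifP => _; rewrite ?branch_rec ?exprS; comring.
rewrite gfD gfZ gf_shiftXUV.
have -> : scalar (- Q ^+ 2) = - scalar (Q ^+ 2).
  by apply/eqP; rewrite -addr_eq0 -scalarD addNr (scalar_nat 0).
by comring.
Qed.

(** The two alternatives of [branch0] meet along the wall [a = n + b], which contains the directions
    [X U] and [U V]. Summing along these leaves two rays, [h1] in the direction of [V] and [h2] in
    that of [U]. *)
Lemma gf_branch0 : gf f_branch0 * (1 - A) * (1 - W) * (1 - U) * (1 - V) =
  scalar (4 * (Q + 1)) * (1 - U) + U * scalar (12 * Q) * (1 - V).
Proof.
pose f1 := cut (fun n a b => (n == 0)%N) (fun n a b => 4 * branch0 0 a b).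
pose h1 := cut (fun n a b => (n == 0) && (a == 0))%N (fun n a b => 4 * (Q + 1)).
pose h2 := cut (fun n a b => [&& n == 0, 0 < a & b == 0])%N (fun n a b =>
  12 * Q).
have s1 : gf f_branch0 * (1 - A) = gf f1.
  apply: gf_geometric gf_shiftXU _ => n a b; rewrite /f_branch0 /f1 /branch0.
  case: n a b => [|n] [|a] b; rewrite /cut /shiftXU /shiftX /shiftU/=
    ?ltnS ?addSn;
    repeat (case: ifP => ? /=); try lia; rewrite ?exprS ?expr0; by comring.
have s2 : gf f1 * (1 - W) = gf (fun n a b => h1 n a b + h2 n a b).
  apply: gf_geometric gf_shiftUV _ => n a b; rewrite /f1 /h1 /h2 /branch0.
  case: n a b => [|n] [|a] [|b]; rewrite /cut /shiftUV /shiftU /shiftV/=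
    ?ltnS ?add0n;
    repeat (case: ifP => ? /=); try lia; rewrite ?exprS ?expr0; by comring.
have s3 : gf h1 * (1 - V) = scalar (4 * (Q + 1)).
  rewrite -gf_delta; apply: gf_geometric1 gf_shiftV _; rewrite /h1; shift_cases.
have s4 : gf h2 * (1 - U) = U * scalar (12 * Q).
  rewrite -gf_delta -gf_shiftU; apply: gf_geometric1 gf_shiftU _; rewrite /h2;
    shift_cases2.
rewrite s1 s2 gfD -s3 -s4; by comring.
Qed.

End GeneratingFunctions.

(** Of the factor [q ^+ 11], four powers come from [Y Z = q^4 u v], and seven clear the denominators
    that arise when the numerator is written in [Y] and [Z] instead of [u] and [v]. *)
Lemma rational_identity (R : comNzRingType) (x u v q sf ss sw st sl sb s0 : R) :
  let A := q ^+ 2 * (x * u) in let B := q ^+ 2 * (x * v) in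
  let W := q * (u * v) in let D := q ^+ 3 * (x * u * v) in
  sf * (1 - x) * (1 - A) * (1 - B) = x * (x * ((q + 1) * (q ^+ 2 + q + 1) * q))
    ->
  ss * (1 - A) * (1 - B) * (1 - D) = x * ((q ^+ 2 + 8 * q + 1) * q) ->
  sw * (1 - v) * (1 - B) * (1 - D) = x * (v * (7 * (q + 1) * q ^+ 2)) ->
  st * (1 - u) * (1 - A) * (1 - D) = x * (u * (6 * (q - 1) * q ^+ 2)) ->
  sl * (1 - D) * (1 - u) * (1 - v) = 6 ->
  sb * (1 - D) = s0 * (1 - q ^+ 2 * (x * u * v)) ->
  s0 * (1 - A) * (1 - W) * (1 - u) * (1 - v) =
    4 * (q + 1) * (1 - u) + u * (12 * q) * (1 - v) ->
  u * (v * (sf + ss + sw + st + sl + sb)) *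
    (q ^+ 11 * (1 - x) * (1 - A) * (1 - B) * (1 - u) * (1 - v) * (1 - W) *
      (1 - D)) =
  (q ^+ 2 * u) * (q ^+ 2 * v) * numerator x (q ^+ 2 * u) (q ^+ 2 * v) q.
Proof.
move=> A B W D hf hs hw ht hl hb h0.
transitivity (q ^+ 11 * u * v * (
    (sf * (1 - x) * (1 - A) * (1 - B)) * ((1 - u) * (1 - v) * (1 - W) * (1 - D))
  + (ss * (1 - A) * (1 - B) * (1 - D)) * ((1 - x) * (1 - u) * (1 - v) * (1 - W))
  + (sw * (1 - v) * (1 - B) * (1 - D)) * ((1 - x) * (1 - A) * (1 - u) * (1 - W))
  + (st * (1 - u) * (1 - A) * (1 - D)) * ((1 - x) * (1 - B) * (1 - v) * (1 - W))
  + (sl * (1 - D) * (1 - u) * (1 - v)) * ((1 - x) * (1 - A) * (1 - B) * (1 - W))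
  + (sb * (1 - D)) * ((1 - x) * (1 - A) * (1 - B) * (1 - u) * (1 - v) *
    (1 - W)))).
  by comring.
rewrite hb.
transitivity (q ^+ 11 * u * v * (
    (sf * (1 - x) * (1 - A) * (1 - B)) * ((1 - u) * (1 - v) * (1 - W) * (1 - D))
  + (ss * (1 - A) * (1 - B) * (1 - D)) * ((1 - x) * (1 - u) * (1 - v) * (1 - W))
  + (sw * (1 - v) * (1 - B) * (1 - D)) * ((1 - x) * (1 - A) * (1 - u) * (1 - W))
  + (st * (1 - u) * (1 - A) * (1 - D)) * ((1 - x) * (1 - B) * (1 - v) * (1 - W))
  + (sl * (1 - D) * (1 - u) * (1 - v)) * ((1 - x) * (1 - A) * (1 - B) * (1 - W))
  + (s0 * (1 - A) * (1 - W) * (1 - u) * (1 - v)) *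
      ((1 - q ^+ 2 * (x * u * v)) * (1 - x) * (1 - B)))).
  by comring.
rewrite hf hs hw ht hl h0 /A /B /W /D /numerator /a0 /a1 /a2 /a3.
by comring.
Qed.

Section Pieces.
Variables (o : idomainType) (pi : o) (q : nat).
Hypothesis dvr : dvr_with_uniformizer pi.
Hypothesis residue : ([set: quotient_module (principal_ideal pi)]%classic #=
  `I_q)%card.
Variable K : comNzRingType.

Lemma total_sum_pieces n a b : total_sum pi K n a.+1 b.+1 =
  f_free K q n a b + f_small K q n a b + f_wide K q n a b + f_tall K q n a b
  + f_large K q n a b + f_branch K q n a b.
Proof.
rewrite /f_free /f_small /f_wide /f_tall /f_large /f_branch /cut.
case: (leqP (a.+1 + b.+1) n) => nab.
  rewrite (total_sum_free dvr residue)//.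
  repeat (case: ifP => ? /=); try lia.
  by rewrite (exprS _ (a + b + a + b)) !exprD; comring.
rewrite (total_sum_bound dvr residue)//.
case: (ltnP a n) => an; case: (ltnP b n) => bn /=;
  repeat (case: ifP => ? /=); try lia.
- rewrite (branch_small _ _ _ (ltnW an)) ?(minn_idPr (ltnW bn)) !exprD
  (exprS _ a); comring.
- rewrite (branch_small _ _ _ (ltnW an)) ?(minn_idPl bn) (exprS _ a); comring.
- rewrite ?(minn_idPr (ltnW bn)) !exprD; comring.
- rewrite ?(minn_idPl bn); comring.
Qed.

End Pieces.

Lemma gf_total (K : comNzRingType) (q : nat) :
  let Q : fps (fps (fps K)) := q%:R in
  let X : fps (fps (fps K)) := fps_const (fps_const (fps_var K)) in
  let U : fps (fps (fps K)) := fps_const (fps_var (fps K)) in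
  let V : fps (fps (fps K)) := fps_var (fps (fps K)) in
  U * (V * gf (fun n a b => f_free K q n a b + f_small K q n a b +
    f_wide K q n a b
     + f_tall K q n a b + f_large K q n a b + f_branch K q n a b)) *
    (Q ^+ 11 * (1 - X) * (1 - Q ^+ 2 * (X * U)) * (1 - Q ^+ 2 * (X * V)) *
      (1 - U)
     * (1 - V) * (1 - Q * (U * V)) * (1 - Q ^+ 3 * (X * U * V))) =
  (Q ^+ 2 * U) * (Q ^+ 2 * V) * numerator X (Q ^+ 2 * U) (Q ^+ 2 * V) Q.
Proof.
move=> Q X U V; rewrite !gfD.
have scalar1 : scalar (1 : K) = 1 := scalar_nat K 1.
have scalarN c : scalar (- c : K) = - scalar c.
  by apply/eqP; rewrite -addr_eq0 -scalarD addNr (scalar_nat K 0).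
have scalarE := (scalarM, scalarD, scalarX, scalarN, scalar_nat, scalar1).
have h1 := gf_free K q; have h2 := gf_small K q; have h3 := gf_wide K q.
have h4 := gf_tall K q; have h5 := gf_large K q; have h6 := gf_branch K q.
have h7 := gf_branch0 K q.
rewrite !scalarE in h1 h2 h3 h4 h5 h6 h7.
exact: rational_identity h1 h2 h3 h4 h5 h6 h7.
Qed.

(** * Division in the ring of power series *)

Definition const_term (F : fps3) : rat := coefs (coefs (coefs F 0) 0) 0.

Lemma const_termM F G : const_term (F * G) = const_term F * const_term G.
Proof. by rewrite /const_term !coefs0M. Qed.

Lemma fps3_unitE (F : fps3) : (F \is a GRing.unit) = (const_term F != 0).
Proof. by rewrite -unitfE !fps_unitE. Qed.

Lemma unit_one_sub (F : fps3) : const_term F = 0 -> 1 - F \is a GRing.unit.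
Proof.
move=> F0; rewrite fps3_unitE.
have -> : const_term (1 - F) = 1 - const_term F by [].
by rewrite F0 subr0 oner_eq0.
Qed.

Lemma const_term_vars :
  [/\ const_term T0 = 0, const_term T1 = 0 & const_term T2 = 0].
Proof. by []. Qed.

Lemma rational_identity_div (R : comUnitRingType) (x u v q S : R) :
  let A := q ^+ 2 * (x * u) in let B := q ^+ 2 * (x * v) in
  let W := q * (u * v) in let D := q ^+ 3 * (x * u * v) in
  let Y := q ^+ 2 * u in let Z := q ^+ 2 * v in
  q \is a GRing.unit -> 1 - x \is a GRing.unit -> 1 - A \is a GRing.unit ->
  1 - B \is a GRing.unit -> 1 - u \is a GRing.unit -> 1 - v \is a GRing.unit ->
  1 - W \is a GRing.unit -> 1 - D \is a GRing.unit ->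
  S * (q ^+ 11 * (1 - x) * (1 - A) * (1 - B) * (1 - u) * (1 - v) * (1 - W) *
    (1 - D))
    = Y * Z * numerator x Y Z q ->
  S = Y * Z * numerator x Y Z q /
    (q ^+ 11 * (1 - x) * (1 - x * Y) * (1 - x * Z) * (1 - q ^- 2 * Y)
     * (1 - q ^- 2 * Z) * (1 - q ^- 3 * Y * Z) * (1 - q^-1 * x * Y * Z)).
Proof.
move=> A B W D Y Z qU xU AU BU uU vU WU DU E.
have -> : q ^- 2 * Y = u by rewrite mulKr ?unitrX.
have -> : q ^- 2 * Z = v by rewrite mulKr ?unitrX.
have -> : q ^- 3 * Y * Z = W.
  have -> : q ^- 3 * Y * Z = q ^- 3 * (q ^+ 3 * W) by rewrite /Y /Z /W; comring.
  by rewrite mulKr ?unitrX.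
have -> : q^-1 * x * Y * Z = D.
  have -> : q^-1 * x * Y * Z = q^-1 * (q * D) by rewrite /Y /Z /D; comring.
  by rewrite mulKr.
have -> : x * Y = A by rewrite /A /Y; comring.
have -> : x * Z = B by rewrite /B /Z; comring.
by rewrite -E mulrK// !unitrMl ?unitrX.
Qed.

Theorem proposition4p2 (o : idomainType) (pi : o) (q : nat)
    (hq : compact_dvr pi q) :
  let Q : fps3 := q%:R in
  let X : fps3 := T0 in
  let Y : fps3 := Q ^+ 2 * T1 in
  let Z : fps3 := Q ^+ 2 * T2 in
  Xi pi =
    Y * Z * numerator X Y Z Q
    / (Q ^+ 11 * (1 - X) * (1 - X * Y) * (1 - X * Z) * (1 - Q ^- 2 * Y)
       * (1 - Q ^- 2 * Z) * (1 - Q ^- 3 * Y * Z) * (1 - Q^-1 * X * Y * Z)).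
Proof.
move=> Q X Y Z; have [dvr _ residue] := hq.
have QU : Q \is a GRing.unit.
  rewrite fps3_unitE /Q -scalar_nat /const_term/= pnatr_eq0 -lt0n.
  exact: ltnW (q_gt1 dvr residue).
have XiE : Xi pi = T1 * (T2 * gf (fun n a b => f_free rat q n a b +
  f_small rat q n a b
    + f_wide rat q n a b + f_tall rat q n a b + f_large rat q n a b +
      f_branch rat q n a b)).
  (* The shifts by [T1] and [T2] undo [a = r1 - 1] and [b = r2 - 1] and supply the zero coefficients
     at [r1 = 0] or [r2 = 0]. *)
  rewrite -gf_shiftV -gf_shiftU; apply: eq_gf => n [|a] [|b] //=.
  by rewrite (h3E dvr residue rat) (total_sum_pieces dvr residue).
have [t0 t1 t2] := const_term_vars.
apply: rational_identity_div QU _ _ _ _ _ _ _ _.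
1-7: apply: unit_one_sub; rewrite ?const_termM ?t0 ?t1 ?t2 ?mulr0; reflexivity.
rewrite XiE; exact: (gf_total rat q).
Qed.
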